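(* Let $m\ge2$ and let $\phi_0(P)=-\frac{dz_P}{z_P}$. In the flat coordinates $t_1,\dots,t_{2m}$ of the metric $\eta(\phi_0)$, the $\phi_0$-prepotential is $$\mathcal F_{\phi_0}=\sum_{k=1}^mt_{2m+1-k}e^{t_k}+\frac12\sum_{k=1}^m(t_{2m+1-k})^2\big(t_k+\log(t_{2m+1-k})\big)+\frac12\sum_{k,s=1,\,s\ne k}^mt_{2m+1-k}t_{2m+1-s}\log\big(e^{t_s}-e^{t_k}\big).$$ The function $\mathcal F_{\phi_0}$ is quasi-homogeneous of degree $2$ with respect to the Euler vector field $\mathbf E_{\phi_0}=\sum_{s=1}^m\big(\partial_{t_s}+t_{2m+1-s}\partial_{t_{2m+1-s}}\big)$, with $$\mathbf E_{\phi_0}.\mathcal F_{\phi_0}=2\mathcal F_{\phi_0}+\sum_{k=1}^m(t_{2m+1-k})^2+\frac12\sum_{k,s=1,\,s\ne k}^mt_{2m+1-k}t_{2m+1-s}.$$ Moreover, $\mathcal F_{\phi_0}$ provides a solution to the generalized WDVV equations: with $F_\alpha=\partial_{t_\alpha}H$, $H$ the Hessian matrix of $\mathcal F_{\phi_0}$, and $\eta$ the constant matrix $\eta_{\alpha\beta}=\delta_{\alpha+\beta,2m+1}$, one has $F_\alpha\eta^{-1}F_\beta=F_\beta\eta^{-1}F_\alpha$ for all $\alpha,\beta=1,\dots,2m$ and $\eta=\sum_\alpha f_\alpha(t)F_\alpha$ for some functions $f_\alpha$ of the coordinates.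
   Context: Consider rational functions $\lambda(P)=\sum_{k=0}^m\frac{b_k}{z_P-a_k}$ on $\mathbb P^1$ with $a_0=0,a_1,\dots,a_m\in\mathbb C$ distinct, $b_0,\dots,b_m\in\mathbb C\setminus\{0\}$, $b_0+\dots+b_m=1$, having $2m$ distinct finite critical points $P_1,\dots,P_{2m}$ (at $z_{P_j}=\alpha_j\neq0$) with distinct critical values $\lambda_j=\lambda(P_j)$. This parametrizes the genus zero Hurwitz space $\mathcal H_{0,m+1}(0,\dots,0)$, of dimension $2m$, with local coordinates $\lambda_1,\dots,\lambda_{2m}$ (equivalently $a_1,\dots,a_m,b_1,\dots,b_m$). Frobenius structure induced by $\phi_0$: metric $\eta(\phi_0)=\frac12\sum_j\phi_0(P_j)^2(d\lambda_j)^2$ with $\phi_0(P_j)=\frac{\phi_0}{dx_j}|_{P_j}$, $x_j=\sqrt{\lambda-\lambda_j}$; multiplication $\partial_{\lambda_i}\circ\partial_{\lambda_j}=\delta_{ij}\partial_{\lambda_j}$; unit $\sum_j\partial_{\lambda_j}$ (not flat); Euler field $\sum_j\lambda_j\partial_{\lambda_j}$. Flat coordinates: for $s=1,\dots,m$, $t_s=\mathrm{p.v.}\int_0^{a_s}\phi_0=\log(b_0)-\log(a_s)$ and $t_{2m+1-s}=\operatorname{res}_{a_s}\lambda\phi_0=-\frac{b_s}{a_s}$. A prepotential is a function $F$ of the flat coordinates with $\partial_{t_\alpha}\partial_{t_\beta}\partial_{t_\gamma}F=\eta(\phi_0)(\partial_{t_\alpha}\circ\partial_{t_\beta},\partial_{t_\gamma})$,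 defined up to polynomials of degree $\le2$; branches of logarithms only affect quadratic terms. *)

(* Defs.v *)
From HB Require Import structures.
From mathcomp Require Import all_boot all_order all_algebra.
From mathcomp Require Import complex.
From mathcomp Require Import all_classical all_reals all_analysis.
Set Implicit Arguments.
Unset Strict Implicit.
Unset Printing Implicit Defensive.
Import Order.TTheory GRing.Theory Num.Theory numFieldNormedType.Exports.
Local Open Scope classical_set_scope.
Local Open Scope ring_scope.
Local Open Scope complex_scope.

(* R[i] viewed as a numClosedFieldType, so that it carries the normed module
   structure over itself and ['D_v f], [derive1 f], [differentiable] are complex
   derivatives. *)
Definition C (R : realType) : numClosedFieldType := R[i].

Definition expC (R : realType) (z : C R) : C R :=
  (expR (complex.Re z) * cos (complex.Im z)) +i*
  (expR (complex.Re z) * sin (complex.Im z)).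

(* "l is a value of log z" *)
Definition is_log (R : realType) (l z : C R) : Prop := expC l = z.

Definition log_branch (R : realType) (n : nat) (U : set 'rV[C R]_n)
    (l g : 'rV[C R]_n -> C R) : Prop :=
  forall t, U t -> {for t, continuous l} /\ is_log (l t) (g t).

(* Positions, in a row vector t of length 2m, of the coordinates t_s and
   t_{2m+1-s}, 1 <= s <= m; the ordinal s : 'I_m stands for s + 1. *)
Definition lo (m : nat) (s : 'I_m) : 'I_(m + m) := lshift m s.
Definition hi (m : nat) (s : 'I_m) : 'I_(m + m) := rev_ord (lshift m s).

Section RationalFunctions.
Variables (R : realType) (m : nat).
Implicit Types (a b : 'I_m.+1 -> C R) (alpha : 'I_(m + m) -> C R).

Definition lambda a b (z : C R) : C R := \sum_(k < m.+1) b k / (z - a k).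

(* (a, b) is a point of the Hurwitz space and alpha an ordering of the finite
   critical points of the corresponding rational function. *)
Record hurwitz_point a b alpha : Prop := HurwitzPoint {
  hurwitz_a0 : a ord0 = 0;
  hurwitz_a_inj : injective a;
  hurwitz_b_neq0 : forall k, b k != 0;
  hurwitz_b_sum : \sum_(k < m.+1) b k = 1;
  hurwitz_alpha_inj : injective alpha;
  hurwitz_alpha_pole : forall j k, alpha j != a k;
  hurwitz_critical : forall j, derive1 (lambda a b) (alpha j) = 0;
  hurwitz_values_inj : injective (fun j => lambda a b (alpha j))
}.

(* t_s = log b_0 - log a_s and t_{2m+1-s} = - b_s / a_s; the logarithms are
   multivalued. *)
Definition flat_coordinates a b (t : 'rV[C R]_(m + m)) : Prop :=
  forall s : 'I_m, let s1 := lift ord0 s in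
    (exists l0 ls, [/\ is_log l0 (b ord0), is_log ls (a s1) &
                       t 0 (lo s) = l0 - ls]) /\
    t 0 (hi s) = - (b s1 / a s1).

End RationalFunctions.

(* x is a branch of sqrt (f - f p) near p; it is a local parameter at p when p
   is a simple critical point of f. *)
Definition sqrt_parameter (R : realType) (f : C R -> C R) (p : C R)
    (x : C R -> C R) : Prop :=
  (\forall z \near p, derivable x z 1) /\
  (\forall z \near p, x z ^+ 2 = f z - f p).

(* Differentials on the z-plane are given by their coefficient of dz;
   phi0 = - dz / z. *)
Definition phi0 (R : realType) (z : C R) : C R := - z^-1.

(* The value at p of (w dz) / dx. *)
Definition over_dx (R : realType) (w x : C R -> C R) (p : C R) : C R :=
  w p / derive1 x p.

(* An open set U of values of the coordinates t, with the inverse (a, b) of the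
   coordinate map over U, continuously ordered critical points alpha _ j and
   local parameters x _ j at them. *)
Record flat_chart (R : realType) (m : nat) (U : set 'rV[C R]_(m + m))
    (a b : 'rV[C R]_(m + m) -> 'I_m.+1 -> C R)
    (alpha : 'rV[C R]_(m + m) -> 'I_(m + m) -> C R)
    (x : 'rV[C R]_(m + m) -> 'I_(m + m) -> C R -> C R) : Prop := FlatChart {
  chart_open : open U;
  chart_hurwitz : forall t, U t -> hurwitz_point (a t) (b t) (alpha t);
  chart_flat : forall t, U t -> flat_coordinates (a t) (b t) t;
  chart_alpha : forall t j, U t -> {for t, continuous (fun u => alpha u j)};
  chart_param : forall t j, U t ->
    sqrt_parameter (lambda (a t) (b t)) (alpha t j) (x t j)
}.

Section Derivatives.
Variables (R : realType) (n : nat).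
Implicit Types (F : 'rV[C R]_n -> C R) (U : set 'rV[C R]_n) (t : 'rV[C R]_n).

Definition pd (i : 'I_n) F t : C R := 'D_(delta_mx 0 i) F t.

Definition holomorphic_on U F : Prop := forall t, U t -> differentiable F t.

Definition hessian F t : 'M[C R]_n := \matrix_(i, j) pd i (pd j F) t.

Definition pd_hessian F (i : 'I_n) t : 'M[C R]_n :=
  \matrix_(k, l) pd i (fun u => hessian F u k l) t.

End Derivatives.

(* Tangent vectors are given by their components in the frame of the
   d/dlambda_j, i.e. X j = dlambda_j(X). *)
Definition circ (R : realType) (n : nat) (X Y : 'I_n -> C R) : 'I_n -> C R :=
  fun j => X j * Y j.

Definition metric (R : realType) (n : nat) (phi X Y : 'I_n -> C R) : C R :=
  2^-1 * \sum_(j < n) phi j ^+ 2 * X j * Y j.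

Section FrobeniusStructure.
Variables (R : realType) (m : nat).
Variables (a b : 'rV[C R]_(m + m) -> 'I_m.+1 -> C R).
Variables (alpha : 'rV[C R]_(m + m) -> 'I_(m + m) -> C R).
Variables (x : 'rV[C R]_(m + m) -> 'I_(m + m) -> C R -> C R).
Implicit Types (t : 'rV[C R]_(m + m)) (i j : 'I_(m + m)).

Definition critical_value t j : C R := lambda (a t) (b t) (alpha t j).

Definition phi0_at t j : C R := over_dx (@phi0 R) (x t j) (alpha t j).

Definition coord_field i t : 'I_(m + m) -> C R :=
  fun j => pd i (fun u => critical_value u j) t.

Definition is_prepotential (U : set 'rV[C R]_(m + m))
    (F : 'rV[C R]_(m + m) -> C R) : Prop :=
  [/\ holomorphic_on U F,
      forall i, holomorphic_on U (pd i F),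
      forall i j, holomorphic_on U (pd i (pd j F)) &
      forall t i j k, U t ->
        pd i (pd j (pd k F)) t =
        metric (phi0_at t) (circ (coord_field i t) (coord_field j t))
          (coord_field k t)].

End FrobeniusStructure.

Section Prepotential.
Variables (R : realType) (m : nat).
Implicit Types (t : 'rV[C R]_(m + m)) (F : 'rV[C R]_(m + m) -> C R).

(* L1 k and L2 k s stand for chosen branches of log t_{2m+1-k} and
   log (e^{t_s} - e^{t_k}). *)
Definition prepotential_phi0 (L1 : 'I_m -> 'rV[C R]_(m + m) -> C R)
    (L2 : 'I_m -> 'I_m -> 'rV[C R]_(m + m) -> C R) t : C R :=
  \sum_(k < m) t 0 (hi k) * expC (t 0 (lo k)) +
  2^-1 * \sum_(k < m) t 0 (hi k) ^+ 2 * (t 0 (lo k) + L1 k t) +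
  2^-1 * \sum_(k < m) \sum_(s < m | s != k)
           t 0 (hi k) * t 0 (hi s) * L2 k s t.

Definition euler F t : C R :=
  \sum_(s < m) (pd (lo s) F t + t 0 (hi s) * pd (hi s) F t).

End Prepotential.

Definition eta_mx (R : realType) (m : nat) : 'M[C R]_(m + m) :=
  \matrix_(i, j) (i.+1 + j.+1 == (m + m).+1)%N%:R.
Arguments eta_mx : clear implicits.

(* Main.v *)
Require Import Defs.
From HB Require Import structures.
From mathcomp Require Import all_boot all_order all_algebra.
From mathcomp Require Import complex ring lra zify.
From mathcomp Require Import all_classical all_reals all_analysis.
Set Implicit Arguments.
Unset Strict Implicit.
Unset Printing Implicit Defensive.
Import Order.TTheory GRing.Theory Num.Theory numFieldNormedType.Exports.
Local Open Scope classical_set_scope.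
Local Open Scope ring_scope.

(* In the coordinate v = b_0 / z, with q_s = e^{t_s} and u_s = t_{2m+1-s}, the
   function lambda becomes G(v) = v + sum_s u_s v / (v - q_s).  At the critical
   points v_j one has d_i lambda_j = (d_i G)(v_j), and
   phi_0(P_j)^2 / 2 = 1 / (v_j^2 G''(v_j)), so that the third derivatives
   predicted by the Frobenius structure are
   E(v g_i g_j g_k), where E(f) = sum_j f(v_j) / G''(v_j) and g_i = (d_i G) / v
   is 1 / (v - q_s) or u_s q_s / (v - q_s)^2.  Lagrange interpolation gives
   E(1 / (v - q_s)) = 1 and E(1 / (v - q_s)^2) = 0; partial fractions and the
   critical equation sum_s u_s q_s / (v - q_s)^2 = 1 then determine every
   E(v g_i g_j g_k), and the results are the derivatives of the Hessian of the
   prepotential.  In the frame of the d/dlambda_j all these tensors are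
   diagonal, whence the WDVV equations. *)

(** * Lagrange interpolation *)

(** The variable [v = b_0 / z] moves the pole at [z = 0] to infinity, so that the flat coordinates
    enter [G] through the positions and weights of its finite poles. Write [G' = N / Q^2] with
    [Q = \prod_s (v - q_s)]; then [N] is monic of degree [2m] and vanishes exactly at the critical
    points. Interpolation there evaluates [E(f)] only when [f = P / Q^2] with [deg P < 2m], whereas
    [v g_i g_j g_k] may have a pole of order six. Partial fractions separate distinct poles;
    multiplying by the critical equation, read as a decomposition of 1, trades a high power at one
    pole for sums already known. The formula for [d_i lambda_j] presupposes that critical points are
    differentiable in [t], while a chart only makes them continuous. An elementary implicit function
    argument supplies this; its condition [G''(v_j) != 0] comes from the simple roots of [N]. *)

Lemma size_prod_XsubC_filter (K : idomainType) (I : finType) (P : pred I)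
    (F : I -> K) :
  size (\prod_(i | P i) ('X - (F i)%:P)) = #|P|.+1.
Proof. by rewrite -big_filter size_prod_XsubC -cardE. Qed.

Lemma horner_prod_XsubC (K : comNzRingType) (I : finType) (P : pred I)
    (F : I -> K) (z : K) :
  (\prod_(i | P i) ('X - (F i)%:P)).[z] = \prod_(i | P i) (z - F i).
Proof. by rewrite horner_prod; apply: eq_bigr => i _; rewrite hornerXsubC. Qed.

Lemma deriv_prod_XsubC_root (K : fieldType) (n : nat) (v : 'I_n -> K) (j : 'I_n) :
  (\prod_i ('X - (v i)%:P))^`().[v j] = \prod_(i | i != j) (v j - v i).
Proof.
rewrite (bigD1 j) //= derivM derivXsubC mul1r hornerD hornerM hornerXsubC subrr.
by rewrite mul0r addr0 horner_prod_XsubC.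
Qed.

(** [P] equals its interpolation polynomial, since the difference has size at most [n] and [n]
    distinct roots. Each basis polynomial [L j] is monic of degree [n - 1], so comparing
    coefficients of that degree gives the sum. *)
Lemma lagrange_lead_coef (K : fieldType) (n : nat) (v : 'I_n -> K) (P : {poly K}) :
  injective v -> (size P <= n)%N ->
  \sum_j P.[v j] / (\prod_i ('X - (v i)%:P))^`().[v j] = P`_n.-1.
Proof.
move=> v_inj sP; pose L j := \prod_(i | i != j) ('X - (v i)%:P).
have Lvv j : (\prod_i ('X - (v i)%:P))^`().[v j] = (L j).[v j].
  by rewrite deriv_prod_XsubC_root horner_prod_XsubC.
have L0 j : (L j).[v j] != 0.
  rewrite horner_prod_XsubC; apply/prodf_neq0 => i ij.
  by rewrite subr_eq0 (inj_eq v_inj) eq_sym.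
have sL j : size (L j) = n.
  rewrite size_prod_XsubC_filter -[RHS](card_ord n).
  rewrite (cardC1 j) prednK // card_ord; exact: leq_ltn_trans (ltn_ord j).
have Ln j : (L j)`_n.-1 = 1.
  have /monicP := monic_prod_XsubC (index_enum 'I_n) (fun i => i != j) v.
  by rewrite lead_coefE -/(L j) sL.
have -> : P = \sum_j (P.[v j] / (L j).[v j]) *: L j.
  apply/eqP; rewrite -subr_eq0; apply/eqP.
  apply: (@roots_geq_poly_eq0 _ _ (codom v)).
  - apply/allP => _ /codomP[j ->]; rewrite rootE hornerD hornerN horner_sum.
    rewrite (bigD1 j) //= hornerZ divfK // big1 ?addr0 ?subrr // => i ij.
    rewrite hornerZ [X in _ * X]horner_prod_XsubC (bigD1 j) 1?eq_sym //=.
    by rewrite subrr mul0r mulr0.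
  - by rewrite codomE map_inj_uniq ?enum_uniq.
  - rewrite size_codom card_ord; apply: (leq_trans (size_polyD _ _)).
    rewrite geq_max sP size_polyN; apply: (leq_trans (size_sum _ _ _)).
    by apply/bigmax_leqP => j _; apply: (leq_trans (size_scale_leq _ _)); rewrite sL.
rewrite coef_sum; apply: eq_bigr => j _; rewrite coefZ Ln mulr1 Lvv.
rewrite horner_sum (bigD1 j) //= hornerZ divfK // big1 ?addr0 // => i ij.
rewrite hornerZ [X in _ * X]horner_prod_XsubC (bigD1 j) 1?eq_sym //=.
by rewrite subrr mul0r mulr0.
Qed.

(** * Sums over the critical points *)

Section CriticalSums.
Variables (K : fieldType) (m : nat).
Variables (q u : 'I_m -> K) (v : 'I_(m + m) -> K).
Hypothesis q_inj : injective q.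
Hypothesis v_inj : injective v.
Hypothesis v_pole : forall j p, v j != q p.

Definition pole p j : K := (v j - q p)^-1.
Hypothesis v_crit : forall j, \sum_p u p * q p * pole p j ^+ 2 = 1.

(* The second derivative of [v + \sum_p u p * v / (v - q p)] at [v j]; by the
   residue theorem [crit_sum f] is minus the sum of the residues of [f / G'] at
   the poles [q p], if [f] has no other pole and vanishes to order 2 at infinity. *)
Definition hess j : K := 2 * \sum_p u p * q p * pole p j ^+ 3.
Definition crit_sum (f : 'I_(m + m) -> K) : K := \sum_j f j / hess j.

Let Q : {poly K} := \prod_i ('X - (q i)%:P).
Let Qd p : {poly K} := \prod_(i | i != p) ('X - (q i)%:P).
(** The numerator of [G'(v) = 1 - \sum_p u p * q p / (v - q p)^2] over the common denominator
    [Q^2]. *)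
Let N : {poly K} := Q ^+ 2 - \sum_p (u p * q p) *: Qd p ^+ 2.

Let v_pole_sub j p : v j - q p != 0.
Proof. by rewrite subr_eq0. Qed.

Let QE p : Q = ('X - (q p)%:P) * Qd p.
Proof. by rewrite /Q (bigD1 p). Qed.

Let Qv j : Q.[v j] != 0.
Proof. by rewrite horner_prod_XsubC; apply/prodf_neq0. Qed.

Let QdE p j : (Qd p).[v j] = Q.[v j] * pole p j.
Proof.
by rewrite (QE p) hornerM hornerXsubC /pole mulrAC mulfV ?mul1r.
Qed.

Let dQdE p j : (Qd p)^`().[v j] = (Q^`().[v j] - Q.[v j] * pole p j) * pole p j.
Proof.
rewrite -QdE (QE p) derivM derivXsubC mul1r hornerD hornerM hornerXsubC.
by rewrite addrC addKr /pole mulrAC mulfV ?mul1r.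
Qed.

Let sQ : size Q = m.+1.
Proof. by rewrite /Q size_prod_XsubC /index_enum -enumT size_enum_ord. Qed.

Let mQ : Q \is monic. Proof. exact: monic_prod_XsubC. Qed.
Let mQd p : Qd p \is monic. Proof. exact: monic_prod_XsubC. Qed.

Let sQd p : size (Qd p) = m.
Proof.
rewrite size_prod_XsubC_filter -[RHS](card_ord m).
rewrite (cardC1 p) prednK // card_ord; exact: leq_ltn_trans (ltn_ord p).
Qed.

Let sQ2 : size (Q ^+ 2) = (m + m).+1.
Proof. by rewrite expr2 size_monicM // ?monic_neq0 // sQ addnS. Qed.

Let sQd2 p : size (Qd p ^+ 2) = (m + m).-1.
Proof. by rewrite expr2 size_monicM // ?monic_neq0 // sQd. Qed.

(** [Q^2] dominates the subtracted sum, so [N] is monic of degree [2m]; the critical equation makes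
    the [2m] distinct [v j] roots of it, which leaves room for no others. *)
Let NE : N = \prod_j ('X - (v j)%:P).
Proof.
have sS : (size (- \sum_p (u p * q p) *: Qd p ^+ 2)%R < size (Q ^+ 2)%R)%N.
  rewrite size_polyN sQ2 ltnS; apply: (leq_trans (size_sum _ _ _)).
  apply/bigmax_leqP => p _; apply: (leq_trans (size_scale_leq _ _)).
  by rewrite sQd2 leq_pred.
have -> : \prod_j ('X - (v j)%:P) = \prod_(z <- codom v) ('X - z%:P).
  by rewrite codomE big_map big_enum.
rewrite [LHS](@all_roots_prod_XsubC _ _ (codom v)).
- by rewrite lead_coefDl // (monicP _) ?monic_exp // scale1r.
- by rewrite size_polyDl // size_codom card_ord.
- apply/allP => _ /codomP[j ->]; rewrite rootE hornerD hornerN horner_sum.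
  under eq_bigr do rewrite hornerZ horner_exp QdE exprMn mulrCA.
  by rewrite -mulr_sumr v_crit mulr1 horner_exp subrr.
- by rewrite uniq_rootsE codomE map_inj_uniq ?enum_uniq.
Qed.

(** Differentiating [N = Q^2 G'] at a zero of [G'] leaves only [Q^2 G'']. This turns the Lagrange
    denominators into [hess]. *)
Let dNE j : (\prod_i ('X - (v i)%:P))^`().[v j] = Q.[v j] ^+ 2 * hess j.
Proof.
rewrite -NE derivB raddf_sum /= hornerD hornerN horner_sum.
rewrite (eq_bigr (fun p => (2 * Q.[v j] * Q^`().[v j]) * (u p * q p * pole p j ^+ 2)
    - (2 * Q.[v j] ^+ 2) * (u p * q p * pole p j ^+ 3))) => [|p _]; last first.
  by rewrite derivZ hornerZ expr2 derivM hornerD !hornerM dQdE QdE; ring.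
rewrite sumrB -!mulr_sumr v_crit /hess expr2 derivM hornerD !hornerM; ring.
Qed.

Lemma hess_neq0 j : hess j != 0.
Proof.
have : (\prod_i ('X - (v i)%:P))^`().[v j] != 0.
  rewrite deriv_prod_XsubC_root; apply/prodf_neq0 => i ij.
  by rewrite subr_eq0 (inj_eq v_inj) eq_sym.
by rewrite dNE mulf_eq0 negb_or => /andP[].
Qed.

Let crit_sum_poly (P : {poly K}) (f : 'I_(m + m) -> K) :
  (forall j, P.[v j] = Q.[v j] ^+ 2 * f j) -> (size P <= m + m)%N ->
  crit_sum f = P`_(m + m).-1.
Proof.
move=> Pf sP; rewrite -(lagrange_lead_coef v_inj sP); apply: eq_bigr => j _.
by rewrite dNE Pf -mulf_div divff ?mul1r // expf_neq0.
Qed.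

(** Over [Q^2] the numerator of [1 / (v - q p)] is [Q * Qd p], monic of degree exactly [2m - 1]. *)
Lemma crit_sum_pole p : crit_sum (pole p) = 1.
Proof.
have mP : Q * Qd p \is monic by rewrite monicMl.
have sP : size (Q * Qd p) = (m + m)%N.
  by rewrite size_monicM ?monic_neq0 // sQ sQd.
rewrite (@crit_sum_poly (Q * Qd p)) ?sP //.
  by move/monicP: mP; rewrite lead_coefE sP.
by move=> j; rewrite hornerM QdE; ring.
Qed.

(** Here the numerator [Qd p ^+ 2] has degree [2m - 2], one short of the coefficient that is read
    off. *)
Lemma crit_sum_pole2 p : crit_sum (fun j => pole p j ^+ 2) = 0.
Proof.
rewrite (@crit_sum_poly (Qd p ^+ 2)) ?sQd2 ?leq_pred //.
  by rewrite nth_default // sQd2.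
by move=> j; rewrite horner_exp QdE exprMn.
Qed.


Let poleM p k j : p != k ->
  pole p j * pole k j = (q p - q k)^-1 * (pole p j - pole k j).
Proof.
move=> pk; have qpk : q p - q k != 0 by rewrite subr_eq0 (inj_eq q_inj).
have v1 := v_pole_sub j p; have v2 := v_pole_sub j k; rewrite /pole; field.
by rewrite qpk v1 v2.
Qed.

Lemma mul_pole p j : v j * pole p j = 1 + q p * pole p j.
Proof. by have v1 := v_pole_sub j p; rewrite /pole; field. Qed.

Let crit_sumD f g : crit_sum (fun j => f j + g j) = crit_sum f + crit_sum g.
Proof. by rewrite -big_split; apply: eq_bigr => j _; rewrite mulrDl. Qed.

Let crit_sumZ c f : crit_sum (fun j => c * f j) = c * crit_sum f.
Proof. by rewrite mulr_sumr; apply: eq_bigr => j _; rewrite mulrA. Qed.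

Let crit_sum_sum (I : finType) (P : pred I) (f : I -> 'I_(m + m) -> K) :
  crit_sum (fun j => \sum_(i | P i) f i j) = \sum_(i | P i) crit_sum (f i).
Proof. by rewrite exchange_big; apply: eq_bigr => j _; rewrite mulr_suml. Qed.

Let eq_crit_sum f g : f =1 g -> crit_sum f = crit_sum g.
Proof. by move=> fg; apply: eq_bigr => j _; rewrite fg. Qed.

Lemma crit_sum_pole11 p k : crit_sum (fun j => pole p j * pole k j) = 0.
Proof.
have [->|pk] := eqVneq p k.
  by rewrite -[RHS](crit_sum_pole2 k); apply: eq_crit_sum => j; rewrite expr2.
rewrite (eq_crit_sum (fun j => poleM j pk)) crit_sumZ.
rewrite (eq_crit_sum (g := fun j => pole p j + (-1) * pole k j)) => [|j].
  by rewrite crit_sumD crit_sumZ !crit_sum_pole mulr1 subrr mulr0.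
by rewrite mulN1r.
Qed.

Let crit_sum_pole12_neq p k : p != k ->
  crit_sum (fun j => pole p j * pole k j ^+ 2) = 0.
Proof.
move=> pk.
rewrite (eq_crit_sum (g := fun j => (q p - q k)^-1 *
    (pole p j * pole k j + (-1) * pole k j ^+ 2))) => [|j].
  rewrite crit_sumZ crit_sumD crit_sumZ crit_sum_pole11 crit_sum_pole2.
  by rewrite mulr0 addr0 mulr0.
by rewrite [in LHS]expr2 mulrA {1}poleM //; ring.
Qed.

Let crit_sum_pole22_neq p k : p != k ->
  crit_sum (fun j => pole p j ^+ 2 * pole k j ^+ 2) = 0.
Proof.
move=> pk; have kp : k != p by rewrite eq_sym.
rewrite (eq_crit_sum (g := fun j => (q p - q k)^-1 *
    (pole k j * pole p j ^+ 2 + (-1) * (pole p j * pole k j ^+ 2)))) => [|j].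
  rewrite crit_sumZ crit_sumD crit_sumZ !crit_sum_pole12_neq //.
  by rewrite mulr0 addr0 mulr0.
rewrite [LHS](_ : _ = pole p j * pole k j * pole p j * pole k j); last by ring.
by rewrite poleM //; ring.
Qed.

(** Inserting 1 in the form of the critical equation raises the pole orders. When all terms but one
    on the right are known, this solves for a sum that [crit_sum_poly] does not reach. *)
Let crit_sum_crit f :
  crit_sum f = \sum_p u p * q p * crit_sum (fun j => pole p j ^+ 2 * f j).
Proof.
rewrite (eq_crit_sum (g := fun j => \sum_p u p * q p * (pole p j ^+ 2 * f j))).
  by rewrite crit_sum_sum; apply: eq_bigr => p _; rewrite crit_sumZ.
by move=> j; under eq_bigr do rewrite mulrA; rewrite -mulr_suml v_crit mul1r.
Qed.

(** For [p = k] the pole is triple; it is the only surviving term when the critical equation is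
    inserted into [crit_sum (pole k) = 1]. Keeping the prefactor [u k * q k] avoids any division. *)
Lemma crit_sum_pole12 p k :
  u k * q k * crit_sum (fun j => pole p j * pole k j ^+ 2) = (p == k)%:R.
Proof.
case: eqVneq => [->|pk]; last by rewrite crit_sum_pole12_neq // mulr0.
rewrite -[RHS](crit_sum_pole k) [RHS]crit_sum_crit (bigD1 k) //= big1 => [|s sk].
  by rewrite addr0; congr (_ * _); apply: eq_crit_sum => j; rewrite mulrC.
rewrite (eq_crit_sum (g := fun j => pole k j * pole s j ^+ 2)) => [|j].
  by rewrite crit_sum_pole12_neq ?mulr0 // eq_sym.
by rewrite mulrC.
Qed.

Lemma crit_sum_pole22 p k :
  u k * q k * crit_sum (fun j => pole p j ^+ 2 * pole k j ^+ 2) = 0.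
Proof.
have [->|pk] := eqVneq p k; last by rewrite crit_sum_pole22_neq // mulr0.
rewrite -[RHS](crit_sum_pole2 k) [RHS]crit_sum_crit (bigD1 k) //= big1 ?addr0 // => s sk.
by rewrite crit_sum_pole22_neq ?mulr0.
Qed.

(* [dG x y] is the derivative of [v + \sum_p u p * v / (v - q p)] at fixed [v]
   when the derivatives of [u] and [q] are [x] and [y]. *)
Definition dG (x y : 'I_m -> K) j : K :=
  v j * \sum_p (x p * pole p j + u p * y p * pole p j ^+ 2).

Variables x y : 'I_m -> K.

(** This is [E(d_i G * f)] for a direction in which [u] and [q] have derivatives [x] and [y]. With
    [x] and [y] arbitrary, all directions are treated at once, and the values on products of two
    [g]'s appear as total derivatives of Hessian entries. *)
Definition dG_sum f : K := crit_sum (fun j => dG x y j * f j).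

Let dG_sumE f : dG_sum f =
  \sum_p (x p * crit_sum (fun j => v j * pole p j * f j) +
     u p * y p * crit_sum (fun j => v j * pole p j * (pole p j * f j))).
Proof.
rewrite /dG_sum (eq_crit_sum (g := fun j => \sum_p (x p * (v j * pole p j * f j)
   + u p * y p * (v j * pole p j * (pole p j * f j))))) => [|j].
  by rewrite crit_sum_sum; apply: eq_bigr => p _; rewrite crit_sumD !crit_sumZ.
rewrite /dG mulr_sumr mulr_suml; apply: eq_bigr => p _; ring.
Qed.

Let crit_sum_mul_pole p f : crit_sum (fun j => v j * pole p j * f j) =
  crit_sum f + q p * crit_sum (fun j => pole p j * f j).
Proof.
rewrite -crit_sumZ -crit_sumD; apply: eq_crit_sum => j; rewrite mul_pole; ring.
Qed.

Lemma dG_sum_pole k : dG_sum (pole k) = y k + \sum_p x p.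
Proof.
rewrite dG_sumE big_split /= addrC; congr (_ + _); last first.
  apply: eq_bigr => p _.
  by rewrite crit_sum_mul_pole crit_sum_pole crit_sum_pole11 mulr0 addr0 mulr1.
have key p :
    u p * crit_sum (fun j => v j * pole p j * (pole p j * pole k j)) = (k == p)%:R.
  rewrite crit_sum_mul_pole crit_sum_pole11 add0r mulrA -(crit_sum_pole12 k p).
  by congr (_ * _); apply: eq_crit_sum => j; ring.
under eq_bigr do rewrite mulrAC key.
rewrite (bigD1 k) //= eqxx mul1r big1 ?addr0 // => p pk.
by rewrite eq_sym (negPf pk) mul0r.
Qed.

Let dG_sum_pole2' k :
  u k * q k * dG_sum (fun j => pole k j ^+ 2) = x k * q k + u k * y k.
Proof.
have key1 p : u k * q k * crit_sum (fun j => v j * pole p j * pole k j ^+ 2)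
    = q p * (p == k)%:R.
  by rewrite crit_sum_mul_pole crit_sum_pole2 add0r -crit_sum_pole12; ring.
have key2 p : u k * q k * crit_sum (fun j => v j * pole p j * (pole p j * pole k j ^+ 2))
    = (p == k)%:R.
  rewrite crit_sum_mul_pole mulrDr crit_sum_pole12 mulrCA.
  rewrite (eq_crit_sum (g := fun j => pole p j ^+ 2 * pole k j ^+ 2)) => [|j].
    by rewrite crit_sum_pole22 mulr0 addr0.
  by ring.
rewrite dG_sumE mulr_sumr (bigD1 k) //= mulrDr ![u k * q k * (_ * crit_sum _)]mulrCA.
rewrite key1 key2 eqxx !mulr1 big1 ?addr0 // => p pk.
rewrite mulrDr ![u k * q k * (_ * crit_sum _)]mulrCA key1 key2 (negPf pk).
by rewrite !mulr0 addr0.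
Qed.

Let dG_sumD f g : dG_sum (fun j => f j + g j) = dG_sum f + dG_sum g.
Proof. by rewrite /dG_sum -crit_sumD; apply: eq_crit_sum => j; rewrite mulrDr. Qed.

Let dG_sumZ c f : dG_sum (fun j => c * f j) = c * dG_sum f.
Proof. by rewrite /dG_sum -crit_sumZ; apply: eq_crit_sum => j; rewrite mulrCA. Qed.

Let eq_dG_sum f g : f =1 g -> dG_sum f = dG_sum g.
Proof. by move=> fg; apply: eq_crit_sum => j; rewrite fg. Qed.

Let dG_sum_crit f :
  dG_sum f = \sum_p dG_sum (fun j => u p * q p * pole p j ^+ 2 * f j).
Proof.
rewrite [LHS]crit_sum_crit; apply: eq_bigr => p _.
by rewrite -crit_sumZ; apply: eq_crit_sum => j; ring.
Qed.

(** The right-hand side is the logarithmic derivative of [q k - q s]. *)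
Lemma dG_sum_pole11 k s : k != s ->
  dG_sum (fun j => pole k j * pole s j) = (y k - y s) / (q k - q s).
Proof.
move=> ks.
rewrite (eq_dG_sum (g := fun j => (q k - q s)^-1 * (pole k j + (-1) * pole s j))).
  by rewrite dG_sumZ dG_sumD dG_sumZ !dG_sum_pole; ring.
by move=> j; rewrite poleM // mulN1r.
Qed.

Hypothesis u_neq0 : forall k, u k != 0.
Hypothesis q_neq0 : forall k, q k != 0.

Lemma dG_sum_pole2 k :
  dG_sum (fun j => pole k j * pole k j) = x k / u k + y k / q k.
Proof.
rewrite (eq_dG_sum (g := fun j => pole k j ^+ 2)) => [|j]; last by rewrite expr2.
have uk := u_neq0 k; have qk := q_neq0 k.
apply: (mulfI (mulf_neq0 uk qk)); rewrite dG_sum_pole2'; field.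
by rewrite uk qk.
Qed.

Lemma dG_sum_pole21 k s : k != s ->
  dG_sum (fun j => u k * q k * pole k j ^+ 2 * pole s j) =
  (x k * q k + u k * y k) / (q k - q s) -
  u k * q k * (y k - y s) / (q k - q s) ^+ 2.
Proof.
move=> ks; rewrite (eq_dG_sum (g := fun j => (q k - q s)^-1 *
  ((u k * q k) * pole k j ^+ 2 + (- (u k * q k)) * (pole k j * pole s j)))) => [|j].
  by rewrite dG_sumZ dG_sumD !dG_sumZ dG_sum_pole2' dG_sum_pole11 // -!exprVn; ring.
rewrite [LHS](_ : _ = pole k j * pole s j * (u k * q k * pole k j)); last by ring.
by rewrite {1}poleM //; ring.
Qed.

Lemma dG_sum_pole22 k s : k != s ->
  dG_sum (fun j => u k * q k * pole k j ^+ 2 * (u s * q s * pole s j ^+ 2)) =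
  (u s * q s * (x k * q k + u k * y k) + u k * q k * (x s * q s + u s * y s))
    / (q k - q s) ^+ 2
  - 2 * u k * q k * u s * q s * (y k - y s) / (q k - q s) ^+ 3.
Proof.
move=> ks; rewrite (eq_dG_sum (g := fun j => ((q k - q s)^-1 ^+ 2) *
  ((u s * q s) * ((u k * q k) * pole k j ^+ 2) +
  ((u k * q k) * ((u s * q s) * pole s j ^+ 2) +
   (- 2 * (u k * q k) * (u s * q s)) * (pole k j * pole s j))))) => [|j].
  rewrite dG_sumZ !dG_sumD !dG_sumZ !dG_sum_pole2' dG_sum_pole11 //.
  by rewrite -!exprVn; ring.
rewrite (_ : _ * _ * _ =
  (u k * q k) * (u s * q s) * (pole k j * pole s j) ^+ 2); last by ring.
by rewrite {1}poleM //; ring.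
Qed.

(** The triple pole is isolated by expanding [dG_sum (pole k)] with the critical equation; the terms
    [s != k] are given by [dG_sum_pole21]. *)
Lemma dG_sum_pole3 k :
  dG_sum (fun j => u k * q k * pole k j ^+ 2 * pole k j) =
  y k + x k + \sum_(s | s != k) ((x s * q k + u s * y k) / (q k - q s)
    - u s * q k * (y k - y s) / (q k - q s) ^+ 2).
Proof.
have := dG_sum_crit (pole k); rewrite (bigD1 k) //= dG_sum_pole => /eqP.
(* The sum of the [x s] coming from [dG_sum_pole] is absorbed term by term into the sum over
   [s != k]. *)
rewrite -subr_eq => /eqP <-; rewrite (bigD1 k) //= addrA -[LHS]addrA -sumrB.
congr (_ + _); apply: eq_bigr => s sk; rewrite dG_sum_pole21 //.
have d1 : q k - q s != 0 by rewrite subr_eq0 (inj_eq q_inj) eq_sym.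
have d2 : q s - q k != 0 by rewrite subr_eq0 (inj_eq q_inj).
by field; rewrite d1 d2.
Qed.

Lemma dG_sum_pole4 k :
  dG_sum (fun j => u k * q k * pole k j ^+ 2 * (u k * q k * pole k j ^+ 2)) =
  x k * q k + u k * y k - \sum_(s | s != k) (
  (u s * q s * (x k * q k + u k * y k) + u k * q k * (x s * q s + u s * y s))
    / (q k - q s) ^+ 2
  - 2 * u k * q k * u s * q s * (y k - y s) / (q k - q s) ^+ 3).
Proof.
have := dG_sum_crit (fun j => u k * q k * pole k j ^+ 2).
rewrite dG_sumZ dG_sum_pole2' (bigD1 k) //= => /eqP.
rewrite -subr_eq => /eqP <-.
by congr (_ - _); apply: eq_bigr => s sk; rewrite -dG_sum_pole22 1?eq_sym //;
  apply: eq_dG_sum => j; rewrite mulrC.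
Qed.

End CriticalSums.

(** * The rational function in flat coordinates *)

Section FlatParametrization.
Variables (K : fieldType) (m : nat).
Variables (a b : 'I_m.+1 -> K) (q u : 'I_m -> K).
Hypothesis a0 : a ord0 = 0.
Hypothesis b0_neq0 : b ord0 != 0.
Hypothesis a_inj : injective a.
Hypothesis qE : forall s, q s = b ord0 / a (lift ord0 s).
Hypothesis uE : forall s, u s = - (b (lift ord0 s) / a (lift ord0 s)).

Let a_neq0 s : a (lift ord0 s) != 0.
Proof. by rewrite -a0 (inj_eq a_inj). Qed.

(** As [b_s = - u_s a_s] and [a_s = b_0 / q_s], the normalization of the [b k] reads
    [b_0 (1 - \sum_s u_s / q_s) = 1], which also shows that the factor to invert is nonzero. *)
Lemma flat_b0 : \sum_k b k = 1 -> b ord0 = (1 - \sum_s u s * (q s)^-1)^-1.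
Proof.
rewrite big_ord_recl => bE.
have e : b ord0 * (1 - \sum_s u s * (q s)^-1) = 1.
  rewrite mulrBr mulr1 mulr_sumr -sumrN -[RHS]bE; congr (_ + _).
  apply: eq_bigr => s _; rewrite uE qE; field.
  by rewrite a_neq0 b0_neq0.
have f0 : 1 - \sum_s u s * (q s)^-1 != 0.
  by apply: contra_eq_neq e => ->; rewrite mulr0 eq_sym oner_neq0.
by apply: (mulIf f0); rewrite e mulVf.
Qed.

Variable z : K.
Hypothesis z_pole : forall k, z != a k.
Let v := b ord0 / z.

Let z_neq0 : z != 0. Proof. by rewrite -a0. Qed.

Lemma flat_pole s : v != q s.
Proof.
rewrite qE; apply: contraNneq (z_pole (lift ord0 s)) => /(mulfI b0_neq0).
by move/invr_inj->.
Qed.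

Let den s : z - a (lift ord0 s) != 0. Proof. by rewrite subr_eq0. Qed.

Let den' s : b ord0 * a (lift ord0 s) + - b ord0 * z != 0.
Proof. by rewrite mulNr -mulrBr mulf_neq0 // -opprB oppr_eq0. Qed.

Lemma flat_lambda :
  \sum_k b k / (z - a k) = v + \sum_s u s * (v * (v - q s)^-1).
Proof.
rewrite big_ord_recl a0 subr0; congr (_ + _); apply: eq_bigr => s _.
by rewrite uE /v qE; field; rewrite a_neq0 z_neq0 den' den.
Qed.

(** The chain rule in algebraic form: [dv/dz = - b_0 / z^2] does not vanish, so critical points in
    [z] are critical points in [v]. *)
Lemma flat_critical : \sum_k b k / (z - a k) ^+ 2 = 0 ->
  \sum_s u s * q s * (v - q s)^-1 ^+ 2 = 1.
Proof.
rewrite big_ord_recl a0 subr0.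
have -> : \sum_(s < m) b (lift ord0 s) / (z - a (lift ord0 s)) ^+ 2 =
    - (b ord0 / z ^+ 2) * \sum_s u s * q s * (v - q s)^-1 ^+ 2.
  rewrite mulr_sumr; apply: eq_bigr => s _; rewrite uE /v qE; field.
  by rewrite a_neq0 ?z_neq0 ?b0_neq0 den' den.
rewrite mulNr -{1}[b ord0 / z ^+ 2]mulr1 -mulrBr => /eqP.
rewrite mulf_eq0 (negPf (mulf_neq0 b0_neq0 (invr_neq0 (expf_neq0 2 z_neq0)))) /=.
by rewrite subr_eq0 => /eqP.
Qed.

(** The sums are half the second derivatives in [z] and in [v]. At a critical point these differ by
    the factor [(dv/dz)^2], and [z^2 (dv/dz)^2 = v^2]. *)
Lemma flat_phi0 : \sum_s u s * q s * (v - q s)^-1 ^+ 2 = 1 ->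
  z ^+ 2 * \sum_k b k / (z - a k) ^+ 3 =
  v ^+ 2 * \sum_s u s * q s * (v - q s)^-1 ^+ 3.
Proof.
move=> crit; rewrite big_ord_recl a0 subr0 mulrDr.
have -> : z ^+ 2 * (b ord0 / z ^+ 3) = v by rewrite /v; field; rewrite z_neq0.
have -> : z ^+ 2 * (\sum_(s < m) b (lift ord0 s) / (z - a (lift ord0 s)) ^+ 3) =
    v * \sum_s u s * q s ^+ 2 * (v - q s)^-1 ^+ 3.
  rewrite !mulr_sumr; apply: eq_bigr => s _; rewrite uE /v qE; field.
  by rewrite a_neq0 ?z_neq0 ?b0_neq0 den' den.
(* The isolated [v], contributed by the pole at [a ord0], is multiplied by the critical equation so
   that it merges with the sum over [s]. *)
rewrite -{1}[v]mulr1 -crit -mulrDr -big_split expr2 -mulrA; congr (_ * _).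
rewrite mulr_sumr; apply: eq_bigr => s _ /=; field.
by rewrite subr_eq0 flat_pole.
Qed.

End FlatParametrization.

(** * Complex differentiability *)

Lemma cvg_shift0 (K : numFieldType) (V : normedModType K) (x : V) :
  h + x @[h --> (0 : V)] --> x.
Proof.
rewrite -[X in _ --> X]add0r; apply: cvgD; [exact: cvg_id|exact: cvg_cst].
Qed.

Lemma cvg_center0 (K : numFieldType) (V : normedModType K) (x : V) :
  z - x @[z --> x] --> (0 : V).
Proof.
rewrite -[X in _ --> X](subrr x); apply: cvgB; [exact: cvg_id|exact: cvg_cst].
Qed.

Lemma diff_near0P (K : numFieldType) (V W : normedModType K) (f : V -> W)
    (x : V) (df : {linear V -> W}) : continuous df ->
  (forall e : K, 0 < e ->
     \forall h \near 0, `|f (h + x) - f x - df h| <= e * `|h|) ->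
  differentiable f x /\ 'd f x = df :> (V -> W).
Proof.
move=> dfc fe.
have fo : f \o shift x = cst (f x) + df +o_ 0 id.
  apply/eqaddoP => e e0; near=> h.
  rewrite [X in `|X|](_ : _ = f (h + x) - f x - df h); last first.
    by rewrite !fctE /= opprD addrA.
  by near: h; exact: fe.
have dfE := diff_unique dfc fo.
by split=> //; apply/diff_locallyP; rewrite dfE.
Unshelve. all: by end_near. Qed.

Lemma diff_near0 (K : numFieldType) (V W : normedModType K) (f : V -> W) (x : V) :
  differentiable f x -> forall e : K, 0 < e ->
    \forall h \near 0, `|f (h + x) - f x - 'd f x h| <= e * `|h|.
Proof.
move=> /diff_locally /eqaddoP fo e e0; apply: filterS (fo e e0) => h.
by rewrite !fctE /= opprD addrA.
Qed.

Lemma near_eq_differentiable (K : numFieldType) (V W : normedModType K)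
    (f g : V -> W) (x : V) :
  (\forall y \near x, f y = g y) -> differentiable f x ->
  differentiable g x /\ 'd g x = 'd f x :> (V -> W).
Proof.
move=> fg df; apply: diff_near0P; first exact: diff_continuous.
have fgx := nbhs_singleton fg.
have fg0 : \forall h \near 0, f (h + x) = g (h + x).
  by move: fg; rewrite (near_shift 0) subr0.
move=> e e0; near=> h; rewrite -fgx -(near fg0 h) //.
by near: h; exact: diff_near0.
Unshelve. all: by end_near. Qed.

(* Carathéodory: the factor [B] need only be continuous where [A] vanishes. *)
Lemma differentiable_mul0 (K : numFieldType) (V : normedModType K)
    (A B : V -> K) (x : V) :
  differentiable A x -> A x = 0 -> {for x, continuous B} ->
  differentiable (fun y => A y * B y) x /\
  'd (fun y => A y * B y) x = B x \*: 'd A x :> (V -> K).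
Proof.
move=> dA A0 cB; apply: diff_near0P.
  by move=> y; apply: continuousZl_tmp; exact: diff_continuous.
have [C C0 dAC] := linear_lipschitz (diff_continuous dA).
move=> e e0; rewrite A0 mul0r.
have C1 : 0 < C + 1 by rewrite addr_gt0.
have B1 : 0 < 2 * (`|B x| + 1) by rewrite mulr_gt0 // ltr_wpDl.
have cB0 : \forall h \near 0, `|B x - B (h + x)| < e / (2 * (C + 1)).
  have /cvgrPdist_lt/(_ _ (divr_gt0 e0 (mulr_gt0 (ltr0Sn _ 1) C1))) := cB.
  exact: cvg_shift0.
near=> h.
have Ah : `|A (h + x)| <= (C + 1) * `|h|.
  have A1 : `|A (h + x) - A x - 'd A x h| <= 1 * `|h|.
    by near: h; exact: diff_near0.
  rewrite -[A (h + x)](subrK ('d A x h)) mulrDl addrC.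
  by rewrite A0 subr0 in A1; apply: le_trans (ler_normD _ _) (lerD (dAC _) A1).
rewrite subr0 [X in `|X|](_ : _ = A (h + x) * (B (h + x) - B x) +
    B x * (A (h + x) - A x - 'd A x h)); last first.
  by rewrite A0 -[LHS]/(A (h + x) * B (h + x) - B x * 'd A x h); ring.
rewrite [e]splitr mulrDl; apply: le_trans (ler_normD _ _) (lerD _ _).
  rewrite normrM mulrC; apply: (@le_trans _ _ (e / (2 * (C + 1)) * ((C + 1) * `|h|))).
    apply: ler_pM => //; rewrite distrC; apply: ltW.
    by near: h; exact: cB0.
  by rewrite mulrA invfM [e * _]mulrA divfK ?gt_eqF.
have A1 : `|A (h + x) - A x - 'd A x h| <= e / (2 * (`|B x| + 1)) * `|h|.
  by near: h; apply: diff_near0 => //; rewrite divr_gt0.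
rewrite normrM; apply: le_trans (ler_wpM2l _ A1) _ => //.
rewrite mulrA; apply: ler_wpM2r => //.
rewrite invfM [e * _]mulrA mulrCA ler_piMr ?divr_ge0 // ?ltW //.
have B2 : 0 < `|B x| + 1 by rewrite ltr_wpDl.
by rewrite ltr_pdivrMr // mul1r ltrDl.
Unshelve. all: by end_near. Qed.

Lemma cvg_at_dist_le (K : numFieldType) (T : topologicalType) (f : T -> K)
    (x : T) (l : K) :
  (forall e : K, 0 < e -> \forall z \near x, `|l - f z| <= e) ->
  f z @[z --> x] --> l.
Proof. by move=> fl; apply/cvgrPdist_le. Qed.

Lemma is_derive_factor (K : numFieldType) (f : K -> K) (x d : K) :
  is_derive x 1 f d -> exists2 psi : K -> K, psi x = d &
  {for x, continuous psi} /\ forall z, f z - f x = (z - x) * psi z.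
Proof.
move=> [df dfE].
have [psi psix psiE] : exists2 psi : K -> K, psi x = d &
    forall z, f z - f x = (z - x) * psi z.
  exists (fun z => if z == x then d else (f z - f x) / (z - x)) => [|z].
    by rewrite eqxx.
  case: eqVneq => [->|zx]; first by rewrite !subrr mul0r.
  by rewrite mulrC divfK // subr_eq0.
exists psi => //; split => //.
rewrite /prop_for /continuous_at psix; apply: cvg_at_dist_le => e e0.
have fx : differentiable f x by apply/derivable1_diffP.
have sx : z - x @[z --> x] --> (0 : K).
  exact: cvg_center0.
have fx0 : \forall z \near x,
    `|f (z - x + x) - f x - 'd f x (z - x)| <= e * `|z - x|.
  exact: sx (diff_near0 fx e0).
apply: filterS fx0 => z; rewrite subrK psiE deriv1E // derive1E dfE.
rewrite (_ : _ *: _ = (z - x) * d) // -mulrBr normrM distrC mulrC.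
have [->|zx] := eqVneq z x; first by move=> _; rewrite psix subrr normr0 ltW.
have xz : 0 < `|x - z| by rewrite normr_gt0 subr_eq0 eq_sym.
by rewrite (ler_pM2r xz) distrC.
Qed.

Lemma near_neq0 (K : numFieldType) (T : topologicalType) (f : T -> K) (t : T) :
  f t != 0 -> {for t, continuous f} -> \forall s \near t, f s != 0.
Proof.
move=> ft0 /cvgrPdist_lt/(_ `|f t|) H; near=> s.
have : `|f t - f s| < `|f t| by near: s; apply: H; rewrite normr_gt0.
by apply: contraTneq => ->; rewrite subr0 ltxx.
Unshelve. all: by end_near. Qed.

(** A substitute for the implicit function theorem: [D] is the defining equation with the unknown
    frozen at [w t], and [A] is its slope in the unknown. As [A] may contain [w] itself, only
    continuity can be asked of it; this suffices because [D] vanishes at [t]. *)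
Lemma differentiable_div0 (K : numFieldType) (V : normedModType K)
    (A D w : V -> K) (t : V) : differentiable D t -> D t = 0 ->
  {for t, continuous A} -> A t != 0 ->
  (\forall s \near t, (w s - w t) * A s = D s) ->
  differentiable w t /\ 'd w t = (A t)^-1 \*: 'd D t :> (V -> K).
Proof.
move=> dD D0 cA A0 wA.
have cB : {for t, continuous (fun s => (A s)^-1)} by apply: cvgV.
have [dDA dDAE] := differentiable_mul0 dD D0 cB.
have dDA1 := differentiableD dDA (differentiable_cst (w t) t).
have wE : \forall s \near t, ((fun s => D s * (A s)^-1) + cst (w t)) s = w s.
  near=> s; rewrite !fctE /=.
  have As : A s != 0 by near: s; exact: near_neq0.
  by rewrite -(near wA s) // mulfK // subrK.
have [dw dwE] := near_eq_differentiable wE dDA1.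
split=> //; rewrite dwE (diffD dDA (differentiable_cst (w t) t)) dDAE diff_cst.
by apply/funext => h; rewrite /= addr0.
Unshelve. all: by end_near. Qed.

(** The slope [psi] of [h] at [l t], composed with [l], is continuous at [t] with value [h'], so
    [l s - l t] is the increment of [g] divided by it. Applied to [h = expC], this differentiates
    any continuous branch of a logarithm. *)
Lemma differentiable_branch (K : numFieldType) (V : normedModType K)
    (h : K -> K) (h' : K) (l g : V -> K) (t : V) :
  is_derive (l t) 1 h h' -> h' != 0 -> {for t, continuous l} ->
  (\forall s \near t, h (l s) = g s) -> differentiable g t ->
  differentiable l t /\ 'd l t = h'^-1 \*: 'd g t :> (V -> K).
Proof.
move=> hh h'0 cl hl dg; have [psi psit [cpsi psiE]] := is_derive_factor hh.
have dgt := differentiableB dg (differentiable_cst (g t) t).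
have gt0 : (g - cst (g t)) t = 0 by rewrite !fctE subrr.
have cpl : {for t, continuous (psi \o l)} by exact: continuous_comp.
have plt : (psi \o l) t != 0 by rewrite /= psit.
have [|dl dlE] := @differentiable_div0 _ _ _ _ l t dgt gt0 cpl plt.
  near=> s; rewrite /= -psiE.
  by rewrite (near hl s) // (nbhs_singleton hl).
split=> //; rewrite dlE (diffB dg (differentiable_cst (g t) t)) diff_cst /= psit.
by apply/funext => u; rewrite /= subr0.
Unshelve. all: by end_near. Qed.

(** * The complex exponential and its derivative *)

Lemma expC0 (R : realType) : expC (0 : C R) = 1.
Proof. by rewrite /expC /= expR0 cos0 sin0 mul1r mulr0. Qed.

Lemma expCD (R : realType) (z w : C R) : expC (z + w) = expC z * expC w.
Proof.
case: z w => [a b] [c d]; rewrite /expC /= expRD cosD sinD; apply/eqP.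
by rewrite eq_complex /=; apply/andP; split; apply/eqP; ring.
Qed.

Lemma expC_neq0 (R : realType) (z : C R) : expC z != 0.
Proof.
apply/eqP => z0; have := expCD z (- z).
by rewrite subrr z0 mul0r expC0 => /eqP; rewrite oner_eq0.
Qed.

Lemma norm_complex_le (R : realType) (x y : R) :
  `|(x +i* y)%C : C R| <= ((`|x| + `|y|)%:C)%C.
Proof.
rewrite (_ : (x +i* y)%C = (x%:C)%C + (y%:C)%C * ('i)%C :> C R); last first.
  by apply/eqP; rewrite eq_complex /=; apply/andP; split; apply/eqP; ring.
apply: le_trans (ler_normD _ _) _; rewrite normrM !normc_def /= expr0n /=.
rewrite expr1n !addr0 add0r sqrtr1 !sqrtr_sqr mulr1.
by rewrite lecE /= addr0 eqxx lexx.
Qed.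

Lemma is_derive_near0 (R : realType) (f : R -> R) (d e : R) : 0 < e ->
  is_derive (0 : R) 1 f d -> \forall h \near 0, `|f h - f 0 - h * d| <= e * `|h|.
Proof.
move=> e0 [df dfE].
have /diff_near0/(_ _ e0) : differentiable f 0 by apply/derivable1_diffP.
by apply: filterS => h; rewrite addr0 deriv1E //= derive1E dfE.
Qed.

(** Complex differentiability at 0 is assembled from the real derivatives at 0 of [expR], [cos] and
    [sin]. *)
Lemma expC_near0 (R : realType) (e : C R) : 0 < e ->
  \forall h \near (0 : C R), `|expC h - 1 - h| <= e * `|h|.
Proof.
(* In the order of the complex numbers a positive number is real. *)
case: e => er ei; rewrite ltcE /= => /andP[/eqP -> er0].
(* The final bound is [e1 * |x| + 5 * e1 * |y|], at most [6 * e1] times the modulus of [x + i y]. *)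
pose e1 := er / 6.
have e10 : 0 < e1 by rewrite divr_gt0.
have /(is_derive_near0 e10) nexp : is_derive (0 : R) 1 expR 1.
  by rewrite -[X in is_derive _ _ _ X]expR0; exact: is_derive_expR.
have /(is_derive_near0 e10) ncos : is_derive (0 : R) 1 (@cos R) 0.
  by apply: is_derive_eq; rewrite sin0 oppr0.
have /(is_derive_near0 e10) nsin : is_derive (0 : R) 1 (@sin R) 1.
  by apply: is_derive_eq; rewrite cos0.
(* The bound by 1 gives [expR x <= 2]; the bound by [e1] controls the cross term
   [(expR x - 1) * y]. *)
have nexp2 : \forall h \near (0 : R), `|expR h - 1| < Num.min e1 1.
  have : expR x @[x --> (0 : R)] --> (1 : R).
    by rewrite -[X in _ --> X]expR0; exact: continuous_expR.
  move=> /cvgrPdist_lt /(_ (Num.min e1 1)) H.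
  near=> h; rewrite distrC; near: h; apply: H.
  by rewrite lt_min e10 /=.
have [d /= d0 dP] : exists2 d : R, 0 < d & forall h : R, `|h| < d ->
    [/\ `|expR h - 1 - h| <= e1 * `|h|, `|cos h - 1| <= e1 * `|h|,
        `|sin h - h| <= e1 * `|h| & `|expR h - 1| < Num.min e1 1].
  have : \forall h \near (0 : R), [/\ `|expR h - 1 - h| <= e1 * `|h|,
      `|cos h - 1| <= e1 * `|h|, `|sin h - h| <= e1 * `|h| &
      `|expR h - 1| < Num.min e1 1].
    near=> h; split.
    - near: h; apply: filterS nexp => h; by rewrite expR0 mulr1.
    - near: h; apply: filterS ncos => h; by rewrite cos0 mulr0 subr0.
    - near: h; apply: filterS nsin => h; by rewrite sin0 subr0 mulr1.
    - by near: h.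
  move=> /nbhs_normP[d d0 dP]; exists d => // h hd; apply: dP.
  by rewrite /= sub0r normrN.
apply/nbhs_normP; exists ((d%:C)%C : C R); first by rewrite /= ltcE /= eqxx.
case=> x y; rewrite /= sub0r normrN => hd.
have Re_le : ((`|x|%:C)%C : C R) <= `|(x +i* y)%C : C R|.
  exact: (normc_ge_Re (x +i* y)%C).
have Im_le : ((`|y|%:C)%C : C R) <= `|(x +i* y)%C : C R|.
  (* Multiplication by [i] keeps the modulus and makes the real part minus the former imaginary
     part. *)
  have := normc_ge_Re ((x +i* y)%C * ('i)%C); rewrite normrM (_ : `|'i%C| = 1).
    by rewrite ReiNIm /= normrN mulr1.
  by rewrite normc_def /= expr0n expr1n add0r sqrtr1.
have [ex1 cx1 sx1 ex2] : [/\ `|expR x - 1 - x| <= e1 * `|x|, `|cos x - 1| <= e1 * `|x|,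
        `|sin x - x| <= e1 * `|x| & `|expR x - 1| < Num.min e1 1].
  by apply: dP; rewrite -ltcR; apply: le_lt_trans hd.
have [ey1 cy1 sy1 ey2] : [/\ `|expR y - 1 - y| <= e1 * `|y|, `|cos y - 1| <= e1 * `|y|,
        `|sin y - y| <= e1 * `|y| & `|expR y - 1| < Num.min e1 1].
  by apply: dP; rewrite -ltcR; apply: le_lt_trans hd.
have -> : expC (x +i* y)%C - 1 - (x +i* y)%C =
   ((expR x * (cos y - 1) + (expR x - 1 - x)) +i*
    (expR x * (sin y - y) + (expR x - 1) * y))%C :> C R.
  by apply/eqP; rewrite eq_complex /=; apply/andP; split; apply/eqP; ring.
apply: le_trans (norm_complex_le _ _) _.
have ex3 : `|expR x| <= 2.
  have -> : expR x = 1 + (expR x - 1) by ring.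
  apply: le_trans (ler_normD _ _) _; rewrite normr1.
  have : `|expR x - 1| < 1 by apply: lt_le_trans ex2 _; rewrite ge_min lexx orbT.
  by move=> /ltW; rewrite -(lerD2l 1).
have ex4 : `|expR x - 1| <= e1.
  by apply: le_trans (ltW ex2) _; rewrite ge_min lexx.
have b1 : `|expR x * (cos y - 1) + (expR x - 1 - x)| <= 2 * (e1 * `|y|) + e1 * `|x|.
  apply: le_trans (ler_normD _ _) (lerD _ ex1).
  by rewrite normrM ler_pM.
have b2 : `|expR x * (sin y - y) + (expR x - 1) * y| <= 2 * (e1 * `|y|) + e1 * `|y|.
  apply: le_trans (ler_normD _ _) (lerD _ _); rewrite normrM; first by rewrite ler_pM.
  by rewrite ler_wpM2r.
apply: (@le_trans _ _ (((e1 * `|x| + 5 * e1 * `|y|)%:C)%C : C R)).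
  by rewrite lecR; lra.
have -> : (er +i* 0)%C = ((e1%:C)%C + ((5 * e1)%:C)%C) :> C R.
  apply/eqP; rewrite eq_complex /= addr0 eqxx andbT /e1; apply/eqP; by field.
rewrite [leRHS]mulrDl (_ : (_%:C)%C = (e1%:C)%C * (`|x|%:C)%C +
    ((5 * e1)%:C)%C * (`|y|%:C)%C :> C R); last first.
  by apply/eqP; rewrite eq_complex /=; apply/andP; split; apply/eqP; ring.
have e1C : (0 : C R) <= (e1%:C)%C by rewrite lecE /= eqxx ltW.
have e5C : (0 : C R) <= ((5 * e1)%:C)%C by rewrite lecE /= eqxx mulr_ge0 ?ltW.
by apply: lerD; apply: ler_wpM2l.
Unshelve. all: by end_near. Qed.

Lemma is_derive_expC (R : realType) (z : C R) : is_derive z 1 (@expC R) (expC z).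
Proof.
pose L := ( *:%R^~ (expC z : C R) : C R -> C R).
have Llin : linear L by move=> a u v; rewrite /L scalerDl scalerA.
pose LM := GRing.isLinear.Build _ _ _ _ _ Llin.
pose LL : {linear _ -> _} := HB.pack L LM.
have [|e e0|de dE] := @diff_near0P _ _ _ (@expC R : C R -> C R) z LL.
- exact: scalel_continuous.
- have ez0 : 0 < `|expC z| by rewrite normr_gt0 expC_neq0.
  have := expC_near0 (divr_gt0 e0 ez0); apply: filterS => h hle.
  rewrite (_ : _ - _ = expC z * (expC h - 1 - h)); last first.
    by rewrite expCD -[LHS]/(_ - h * expC z); ring.
  by rewrite normrM mulrC -ler_pdivlMr // mulrAC.
apply: DeriveDef; first by apply/derivable1_diffP.
by rewrite deriveE // dE /= /L scale1r.
Qed.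

(** * Gradient calculus in several complex variables *)

Section Gradient.
Variables (R : realType) (n : nat).
Implicit Types (F G : 'rV[C R]_n -> C R) (t : 'rV[C R]_n) (g : 'I_n -> C R).

Definition has_grad F t g : Prop :=
  differentiable F t /\ forall i, pd i F t = g i.

Lemma has_grad_pd F t g i : has_grad F t g -> pd i F t = g i.
Proof. by case. Qed.

Lemma has_gradP F t (df : 'rV[C R]_n -> C R) g : differentiable F t ->
  'd F t = df :> (_ -> _) -> (forall i, df (delta_mx 0 i) = g i) ->
  has_grad F t g.
Proof. by move=> dF dfE gE; split=> // i; rewrite /pd deriveE // dfE. Qed.

Lemma has_grad_diff F t g i : has_grad F t g -> 'd F t (delta_mx 0 i) = g i.
Proof. by move=> [dF <-]; rewrite /pd deriveE. Qed.

Lemma eq_has_grad F t g g' : has_grad F t g -> g =1 g' -> has_grad F t g'.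
Proof. by move=> [dF gE] gg'; split=> // i; rewrite gE. Qed.

Lemma has_grad_cst (c : C R) t : has_grad (fun=> c) t (fun=> 0).
Proof.
apply: has_gradP (differentiable_cst c t) (diff_cst c t) _ => i //.
Qed.

Lemma has_grad_coord (k : 'I_n) t : has_grad (fun s => s 0 k) t (fun i => (i == k)%:R).
Proof.
split=> [|i]; first exact: differentiable_coord.
rewrite /pd deriveE; last exact: differentiable_coord.
have @f : {linear 'rV[C R]_n -> C R}.
  by exists (fun N : 'rV[C R]_n => N 0 k); do 2![eexists]; do ?[constructor];
     rewrite ?mxE// => ? *; rewrite ?mxE//; move=> ?; rewrite !mxE.
rewrite (_ : (fun _ => _) = f) // diff_lin //=; last exact: coord_continuous.
by rewrite mxE eqxx eq_sym.
Qed.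

Lemma has_gradD F G t f g : has_grad F t f -> has_grad G t g ->
  has_grad (fun s => F s + G s) t (fun i => f i + g i).
Proof.
move=> hF hG; have [dF _] := hF; have [dG _] := hG.
apply: has_gradP (differentiableD dF dG) (diffD dF dG) _ => i.
by rewrite -(has_grad_diff i hF) -(has_grad_diff i hG).
Qed.

Lemma has_gradM F G t f g : has_grad F t f -> has_grad G t g ->
  has_grad (fun s => F s * G s) t (fun i => f i * G t + F t * g i).
Proof.
move=> hF hG; have [dF _] := hF; have [dG _] := hG.
apply: has_gradP (differentiableM dF dG) (diffM dF dG) _ => i /=.
rewrite -(has_grad_diff i hF) -(has_grad_diff i hG) addrC [in RHS]mulrC.
by [].
Qed.

Lemma has_gradZ c F t f : has_grad F t f ->
  has_grad (fun s => c * F s) t (fun i => c * f i).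
Proof.
move=> hF; apply: eq_has_grad (has_gradM (has_grad_cst c t) hF) _ => i.
by rewrite mul0r add0r.
Qed.

Lemma has_gradB F G t f g : has_grad F t f -> has_grad G t g ->
  has_grad (fun s => F s - G s) t (fun i => f i - g i).
Proof.
move=> hF hG.
have -> : (fun s => F s - G s) = (fun s => F s + (-1) * G s).
  by apply/funext => s; rewrite mulN1r.
apply: eq_has_grad (has_gradD hF (has_gradZ (-1) hG)) _ => i.
by rewrite mulN1r.
Qed.

Lemma has_grad_sum (I : finType) (P : pred I) (F : I -> 'rV[C R]_n -> C R) t
    (f : I -> 'I_n -> C R) : (forall k, P k -> has_grad (F k) t (f k)) ->
  has_grad (fun s => \sum_(k | P k) F k s) t (fun i => \sum_(k | P k) f k i).
Proof.
move=> hF; elim: (index_enum I) => [|k r IH].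
  under eq_fun do rewrite big_nil; apply: eq_has_grad (has_grad_cst 0 t) _ => i.
  by rewrite big_nil.
under eq_fun do rewrite big_cons.
have [Pk|Pk] := boolP (P k); last first.
  by apply: eq_has_grad IH _ => i; rewrite big_cons (negPf Pk).
by apply: eq_has_grad (has_gradD (hF k Pk) IH) _ => i; rewrite big_cons Pk.
Qed.

Lemma has_grad_comp (h : C R -> C R) (h' : C R) F t f :
  is_derive (F t) 1 h h' -> has_grad F t f ->
  has_grad (fun s => h (F s)) t (fun i => h' * f i).
Proof.
move=> [dh dhE] hF; have [dF _] := hF.
have dh1 : differentiable h (F t) by apply/derivable1_diffP.
apply: has_gradP (differentiable_comp dF dh1) (diff_comp dF dh1) _ => i /=.
by rewrite -(has_grad_diff i hF) deriv1E // derive1E dhE mulrC.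
Qed.

Lemma has_grad_expC F t f : has_grad F t f ->
  has_grad (fun s => expC (F s)) t (fun i => expC (F t) * f i).
Proof. by apply: has_grad_comp; exact: is_derive_expC. Qed.

Lemma has_gradV F t f : F t != 0 -> has_grad F t f ->
  has_grad (fun s => (F s)^-1) t (fun i => - f i / F t ^+ 2).
Proof.
move=> F0 hF; have [dF _] := hF.
apply: has_gradP (differentiableV dF F0) (diffV dF F0) _ => i.
rewrite -(has_grad_diff i hF) mulNr mulrC -mulNr.
by [].
Qed.

Lemma near_has_grad F G t g : (\forall s \near t, F s = G s) ->
  has_grad F t g -> has_grad G t g.
Proof.
move=> FG hF; have [dF _] := hF; have [dG dGE] := near_eq_differentiable FG dF.
by apply: has_gradP dG dGE _ => i; exact: has_grad_diff.
Qed.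

(** Partial derivatives are computed only on [U]; since [U] is open, a formula valid there can be
    differentiated again. *)
Lemma open_has_grad (U : set 'rV[C R]_n) F G t g : open U -> U t ->
  (forall s, U s -> F s = G s) -> has_grad F t g -> has_grad G t g.
Proof.
move=> oU Ut FG; apply: near_has_grad.
by apply: filterS (open_nbhs_nbhs (conj oU Ut)) => s; exact: FG.
Qed.

Lemma has_grad_div0 (A D w : 'rV[C R]_n -> C R) t g : has_grad D t g ->
  D t = 0 -> {for t, continuous A} -> A t != 0 ->
  (\forall s \near t, (w s - w t) * A s = D s) ->
  has_grad w t (fun i => g i / A t).
Proof.
move=> hD D0 cA A0 wA; have [dD _] := hD.
have [dw dwE] := differentiable_div0 dD D0 cA A0 wA.
by apply: has_gradP dw dwE _ => i; rewrite -(has_grad_diff i hD) mulrC.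
Qed.

Lemma has_grad_log (U : set 'rV[C R]_n) (l G : 'rV[C R]_n -> C R) t g :
  open U -> U t -> log_branch U l G -> has_grad G t g ->
  has_grad l t (fun i => g i / G t).
Proof.
move=> oU Ut hl hG; have [dG _] := hG; have [lc lG] := hl _ Ut.
have lGU : \forall s \near t, expC (l s) = G s.
  by apply: filterS (open_nbhs_nbhs (conj oU Ut)) => s /hl[].
have [dl dlE] := differentiable_branch (is_derive_expC (l t)) (expC_neq0 _)
  lc lGU dG.
apply: has_gradP dl dlE _ => i; rewrite -(has_grad_diff i hG) -lG mulrC.
by [].
Qed.

End Gradient.

(** * Critical points on a flat chart *)

Lemma hi_inj (m : nat) : injective (@hi m).
Proof. by move=> s p /rev_ord_inj/lshift_inj. Qed.

Lemma lo_inj (m : nat) : injective (@lo m).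
Proof. exact: lshift_inj. Qed.

Lemma lo_neq_hi (m : nat) (s p : 'I_m) : (lo s == hi p) = false.
Proof.
by rewrite -val_eqE /=; have := ltn_ord s; have := ltn_ord p; lia.
Qed.

Variant lo_hi_spec (m : nat) : 'I_(m + m) -> Type :=
  | IsLo s : lo_hi_spec (lo s)
  | IsHi s : lo_hi_spec (hi s).

Lemma lo_hiP (m : nat) (i : 'I_(m + m)) : lo_hi_spec i.
Proof.
have [im|mi] := ltnP i m.
  by rewrite (_ : i = lo (Ordinal im)); [left|exact: val_inj].
have ri : (rev_ord i < m)%N by rewrite /=; have := ltn_ord i; lia.
rewrite (_ : i = hi (Ordinal ri)); first by right.
by rewrite /hi (_ : lshift _ _ = rev_ord i) ?rev_ordK //; exact: val_inj.
Qed.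

Lemma is_derive_pole (K : numFieldType) (c p z : K) : z != p ->
  is_derive z 1 (fun w => c / (w - p)) (- (c / (z - p) ^+ 2)).
Proof.
move=> zp; have zp0 : z - p != 0 by rewrite subr_eq0.
have h : is_derive z 1 (fun w => w - p) 1.
  by apply: is_derive_eq; rewrite subr0.
have [dh hE] := h.
have dV : derivable (fun w => (w - p)^-1) z 1 by exact: derivableV.
have dVE : is_derive z 1 (fun w => (w - p)^-1) (- (z - p) ^- 2).
  by apply: DeriveDef => //; rewrite deriveV // hE [LHS]mulr1.
have := is_deriveZ c dVE.
by move/(is_derive_eq); apply; rewrite -mulrN.
Qed.

Lemma is_derive_pole_sum (K : numFieldType) (n : nat) (c p : 'I_n -> K) (z : K) :
  (forall k, z != p k) ->
  is_derive z 1 (fun w => \sum_k c k / (w - p k))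
    (- \sum_k c k / (z - p k) ^+ 2).
Proof.
move=> zp; have := is_derive_sum (fun k => is_derive_pole (c k) (zp k)).
rewrite -sumrN; congr is_derive.
by apply/funext => w; rewrite fct_sumE.
Qed.

Lemma eq_at_continuous (K : numFieldType) (f g : K -> K) (x : K) :
  {for x, continuous f} -> {for x, continuous g} ->
  (\forall z \near x, z != x -> f z = g z) -> f x = g x.
Proof.
move=> cf cg fg.
have cf' : f @ x^' --> f x by apply: cvg_trans cf; apply: cvg_app; exact: cvg_within.
have cg' : g @ x^' --> g x by apply: cvg_trans cg; apply: cvg_app; exact: cvg_within.
apply: (cvg_unique (@norm_hausdorff K K) cf').
apply: cvg_trans cg'; apply: near_eq_cvg.
by apply: filterS fg => z fgz zx; apply/esym/fgz.
Qed.

Lemma continuous_bigsum (K : numFieldType) (T : topologicalType) (I : finType)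
    (f : I -> T -> K) (t : T) : (forall i, {for t, continuous (f i)}) ->
  {for t, continuous (fun s => \sum_i f i s)}.
Proof.
move=> cf; elim: (index_enum I) => [|i r IH].
  rewrite (_ : (fun s => _) = cst 0); first exact: cst_continuous.
  by apply/funext => s; rewrite big_nil.
rewrite (_ : (fun s => _) = f i \+ (fun s => \sum_(j <- r) f j s)).
  exact: continuousD (cf i) IH.
by apply/funext => s; rewrite big_cons.
Qed.

Section Chart.
Variables (R : realType) (m : nat).
Implicit Types (t : 'rV[C R]_(m + m)).

Definition cu t (s : 'I_m) : C R := t 0 (hi s).
Definition cq t (s : 'I_m) : C R := expC (t 0 (lo s)).
(* [dU i s], [dT i s] and [dQ t i s] are the derivatives of [cu t s], of the
   coordinate [lo s] and of [cq t s] in the direction [i]. *)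
Definition dU (i : 'I_(m + m)) (s : 'I_m) : C R := (i == hi s)%:R.
Definition dT (i : 'I_(m + m)) (s : 'I_m) : C R := (i == lo s)%:R.
Definition dQ t i s : C R := cq t s * dT i s.

Lemma has_grad_u s t : has_grad (fun t => cu t s) t (fun i => dU i s).
Proof. exact: has_grad_coord. Qed.

Lemma has_grad_q s t : has_grad (fun t => cq t s) t (fun i => dQ t i s).
Proof. exact: has_grad_expC (has_grad_coord (lo s) t). Qed.

Lemma cq_neq0 t s : cq t s != 0. Proof. exact: expC_neq0. Qed.

Variables (U : set 'rV[C R]_(m + m)) (a b : 'rV[C R]_(m + m) -> 'I_m.+1 -> C R).
Variables (alpha : 'rV[C R]_(m + m) -> 'I_(m + m) -> C R).
Variables (x : 'rV[C R]_(m + m) -> 'I_(m + m) -> C R -> C R).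
Hypothesis hU : flat_chart U a b alpha x.

(* The critical points in the coordinate [b_0 / z]; the first factor is [b_0]
   expressed in flat coordinates, so that it makes sense outside [U]. *)
Definition crit_pt t j : C R := (1 - \sum_s cu t s * (cq t s)^-1)^-1 / alpha t j.

Section Point.
Variable t : 'rV[C R]_(m + m).
Hypothesis Ut : U t.
Let hp := chart_hurwitz hU Ut.

Let a0 : a t ord0 = 0 := hurwitz_a0 hp.
Let a_inj : injective (a t) := hurwitz_a_inj hp.
Let b_neq0 k : b t k != 0 := hurwitz_b_neq0 hp k.
Let b0_neq0 := b_neq0 ord0.

Let a_neq0 s : a t (lift ord0 s) != 0.
Proof. by rewrite -a0 (inj_eq a_inj). Qed.

(** Exponentiation removes the choice of the logarithms in the flat coordinate. *)
Lemma chart_q s : cq t s = b t ord0 / a t (lift ord0 s).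
Proof.
have [[l0 [ls [l0E lsE tE]]] _] := chart_flat hU Ut s.
rewrite /cq tE; apply: (mulIf (a_neq0 s)); rewrite divfK //.
by rewrite -[X in _ * X]lsE -expCD subrK.
Qed.

Lemma chart_u s : cu t s = - (b t (lift ord0 s) / a t (lift ord0 s)).
Proof. by have [] := chart_flat hU Ut s. Qed.

Lemma chart_b0 : b t ord0 = (1 - \sum_s cu t s * (cq t s)^-1)^-1.
Proof.
exact: (@flat_b0 (C R) m (a t) (b t) (cq t) (cu t) a0 b0_neq0 a_inj chart_q chart_u
  (hurwitz_b_sum hp)).
Qed.

Lemma crit_ptE j : crit_pt t j = b t ord0 / alpha t j.
Proof. by rewrite chart_b0. Qed.

Lemma cu_neq0 s : cu t s != 0.
Proof. by rewrite chart_u oppr_eq0 mulf_neq0 ?invr_eq0. Qed.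

Lemma cq_inj : injective (cq t).
Proof.
move=> s p; rewrite !chart_q => /(mulfI b0_neq0)/invr_inj/a_inj.
exact: lift_inj.
Qed.

Let alpha_neq0 j : alpha t j != 0.
Proof. by have := hurwitz_alpha_pole hp j ord0; rewrite a0. Qed.

Lemma crit_pt_neq0 j : crit_pt t j != 0.
Proof. by rewrite crit_ptE mulf_neq0 ?invr_eq0. Qed.

Lemma crit_pt_inj : injective (crit_pt t).
Proof.
move=> i j; rewrite !crit_ptE => /(mulfI b0_neq0)/invr_inj.
exact: hurwitz_alpha_inj hp _ _.
Qed.

Lemma crit_pt_pole j s : crit_pt t j != cq t s.
Proof.
rewrite crit_ptE.
exact: (@flat_pole (C R) m (a t) (b t) (cq t) b0_neq0 chart_q _
  (hurwitz_alpha_pole hp j) s).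
Qed.

Lemma critical_value_crit_pt j : critical_value a b alpha t j =
  crit_pt t j + \sum_s cu t s * (crit_pt t j * (crit_pt t j - cq t s)^-1).
Proof.
rewrite crit_ptE.
exact: (@flat_lambda (C R) m (a t) (b t) (cq t) (cu t) a0 b0_neq0 a_inj chart_q
  chart_u _ (hurwitz_alpha_pole hp j)).
Qed.

Lemma chart_critical j : \sum_k b t k / (alpha t j - a t k) ^+ 2 = 0.
Proof.
have [_ lE] := is_derive_pole_sum (b t) (hurwitz_alpha_pole hp j).
have := hurwitz_critical hp j; rewrite derive1E lE => /eqP.
by rewrite oppr_eq0 => /eqP.
Qed.

Lemma crit_ptP j :
  \sum_s cu t s * cq t s * pole (cq t) (crit_pt t) s j ^+ 2 = 1.
Proof.
rewrite /pole crit_ptE.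
exact: (@flat_critical (C R) m (a t) (b t) (cq t) (cu t) a0 b0_neq0 a_inj chart_q
  chart_u _ (hurwitz_alpha_pole hp j) (chart_critical j)).
Qed.

(** The value is half of [lambda''] at [p]. With [x z = (z - p) * psi z] and
    [lambda z - lambda p = (z - p)^2 * S z], one has [psi^2 = S] near [p] off [p], hence at [p] by
    continuity, where [psi] is the derivative of [x]. *)
Lemma deriv_sqrt_sqr j : derive1 (x t j) (alpha t j) ^+ 2 =
  \sum_k b t k / (alpha t j - a t k) ^+ 3.
Proof.
set p := alpha t j.
have [dx xE] := chart_param hU j Ut.
have xp : x t j p = 0.
  by have /eqP := nbhs_singleton xE; rewrite subrr expf_eq0 /= => /eqP.
have [psi psip [cpsi psiE]] := is_derive_factor (derivableP (nbhs_singleton dx)).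
rewrite derive1E -psip.
pose S z := \sum_k b t k / (p - a t k) ^+ 2 / (z - a t k).
have pk k : p - a t k != 0 by rewrite subr_eq0; exact: hurwitz_alpha_pole hp j k.
have dS : differentiable S p.
  apply/derivable1_diffP.
  by have [] := is_derive_pole_sum (fun k => b t k / (p - a t k) ^+ 2)
    (hurwitz_alpha_pole hp j).
have -> : \sum_k b t k / (p - a t k) ^+ 3 = S p.
  by apply: eq_bigr => k _; have pk0 := pk k; field.
apply: (@eq_at_continuous _ (fun z => psi z ^+ 2) S).
- by apply: (@continuousM _ _ psi psi).
- exact: differentiable_continuous.
have nk k : \forall z \near p, z - a t k != 0.
  apply: (@near_neq0 _ _ (fun z => z - a t k)) (pk k) _.
  apply: differentiable_continuous.
  apply: differentiableB; last exact: differentiable_cst.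
  by apply/derivable1_diffP; exact: derivable_id.
have {}nk : \forall z \near p, forall k, z - a t k != 0.
  exact: (@filter_forall _ _ _ _ (nbhs_filter p) nk).
near=> z => zp.
have zk k : z - a t k != 0 by move: k; near: z.
apply: (mulfI (expf_neq0 2 (_ : z - p != 0))); first by rewrite subr_eq0.
rewrite -exprMn -psiE xp subr0 (near xE z) // /lambda.
have cr : \sum_k b t k / (p - a t k) ^+ 2 = 0 := chart_critical j.
(* Adding [z - p] times the critical equation cancels the first-order term and produces the second
   factor [z - p]. *)
rewrite -sumrB -[LHS]addr0 -[X in _ + X = _](mulr0 (z - p)).
rewrite -[X in _ + _ * X = _]cr -/p /S !mulr_sumr -big_split /=.
apply: eq_bigr => k _; have z1 := pk k; have z2 := zk k; field.
by rewrite z1 z2.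
Unshelve. all: by end_near. Qed.

(** The factor 1/2 of the metric supplies the 2 of [hess], since the square of the derivative of [x]
    is only half of [lambda'']. *)
Lemma phi0_at_sqr j : 2^-1 * phi0_at alpha x t j ^+ 2 =
  (crit_pt t j ^+ 2 * hess (cq t) (cu t) (crit_pt t) j)^-1.
Proof.
have e := (@flat_phi0 (C R) m (a t) (b t) (cq t) (cu t)) a0 b0_neq0 a_inj chart_q
  chart_u _ (hurwitz_alpha_pole hp j).
rewrite /phi0_at /over_dx /phi0 exprMn sqrrN [X in _ * (_ * X)]exprVn deriv_sqrt_sqr.
rewrite exprVn -!invfM e -?crit_ptE; last exact: crit_ptP.
by rewrite /hess mulrCA.
Qed.

End Point.

End Chart.

(** One summand of the difference of [u q / (v - q)^2] between [v] and [w], divided by [w - v]; in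
    this form it stays continuous where [v] and [w] meet. *)
Lemma continuous_crit_slope (K : numFieldType) (T : topologicalType)
    (u q v w : T -> K) (t : T) :
  {for t, continuous q} -> {for t, continuous v} -> {for t, continuous u} ->
  {for t, continuous w} -> v t - q t != 0 -> w t - q t != 0 ->
  {for t, continuous (fun s => u s * q s * ((w s - q s)^-1 * (w s - q s)^-1) *
     ((v s - q s)^-1 * (v s - q s)^-1) * (v s + w s - 2 * q s))}.
Proof.
move=> cq cv cu cw vq wq.
have inv f : {for t, continuous f} -> f t - q t != 0 ->
    {for t, continuous (fun s => (f s - q s)^-1)}.
  by move=> cf f0; apply: cvgV => //; exact: cvgB.
have cv' := inv _ cv vq; have cw' := inv _ cw wq.
apply: cvgM; last first.
  apply: cvgB; first exact: cvgD.
  by apply: cvgM => //; exact: cvg_cst.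
apply: cvgM; last exact: cvgM.
by apply: cvgM; exact: cvgM.
Qed.

(** * Differentiability of the critical points and gradients of the critical values *)

Section CriticalPoints.
Variables (R : realType) (m : nat).
Implicit Types (t : 'rV[C R]_(m + m)).
Variables (U : set 'rV[C R]_(m + m)) (a b : 'rV[C R]_(m + m) -> 'I_m.+1 -> C R).
Variables (alpha : 'rV[C R]_(m + m) -> 'I_(m + m) -> C R).
Variables (x : 'rV[C R]_(m + m) -> 'I_(m + m) -> C R -> C R).
Hypothesis hU : flat_chart U a b alpha x.
Local Notation crit_pt := (crit_pt alpha).

(** Existence of a gradient is enough: in the derivative of a critical value it is multiplied by
    [G'(v_j) = 0]. *)
Lemma has_grad_crit_pt t j : U t -> exists w, has_grad (fun s => crit_pt s j) t w.
Proof.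
move=> Ut; have calpha := chart_alpha hU (j := j) Ut.
have alpha0 : alpha t j != 0.
  rewrite -(hurwitz_a0 (chart_hurwitz hU Ut)).
  exact: (hurwitz_alpha_pole (chart_hurwitz hU Ut)).
have b0 := hurwitz_b_neq0 (chart_hurwitz hU Ut) ord0.
pose v0 := crit_pt t j.
have cv : {for t, continuous (fun s => crit_pt s j)}.
  apply: (@continuousM _ _ (fun s => (1 - \sum_p cu s p * (cq s p)^-1)^-1)
    (fun s => (alpha s j)^-1)); last by apply: continuousV.
  apply: continuousV; first by rewrite /= -invr_eq0 -(chart_b0 hU Ut).
  apply: differentiable_continuous.
  suff [g []] : exists g, has_grad (fun s => 1 - \sum_p cu s p * (cq s p)^-1) t g by [].
  eexists; apply: has_gradB; first exact: has_grad_cst.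
  apply: has_grad_sum => p _; apply: has_gradM; first exact: has_grad_u.
  apply: has_gradV; [exact: cq_neq0|exact: has_grad_q].
have rho0 p : v0 - cq t p != 0 by rewrite subr_eq0 (crit_pt_pole hU).
have rhos s p : U s -> crit_pt s j - cq s p != 0.
  by move=> Us; rewrite subr_eq0 (crit_pt_pole hU).
(* Subtracting the critical equations at [s] and at [t], both with the
   parameters of [s], gives [D s = (crit_pt s j - v0) * A s]. *)
pose D (s : 'rV[C R]_(m + m)) : C R :=
  \sum_p cu s p * cq s p * ((v0 - cq s p)^-1 * (v0 - cq s p)^-1) - 1.
pose A (s : 'rV[C R]_(m + m)) : C R :=
  \sum_p cu s p * cq s p * ((v0 - cq s p)^-1 * (v0 - cq s p)^-1) *
  ((crit_pt s j - cq s p)^-1 * (crit_pt s j - cq s p)^-1) *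
  (crit_pt s j + v0 - 2 * cq s p).
have gD1 p : exists g, has_grad
    (fun s => cu s p * cq s p * ((v0 - cq s p)^-1 * (v0 - cq s p)^-1)) t g.
  have gV : has_grad (fun s => (v0 - cq s p)^-1) t _ :=
    has_gradV (rho0 p) (has_gradB (has_grad_cst v0 t) (has_grad_q p t)).
  eexists; apply: has_gradM (has_gradM gV gV).
  exact: has_gradM (has_grad_u p t) (has_grad_q p t).
have [gD hD] : exists g, has_grad D t g.
  have [g hg] := boolp.choice gD1.
  eexists; apply: has_gradB; last exact: has_grad_cst.
  by apply: has_grad_sum => p _; exact: hg.
have D0 : D t = 0.
  apply/eqP; rewrite subr_eq0 -(crit_ptP hU Ut j); apply/eqP; apply: eq_bigr => p _.
  by rewrite expr2.
have cq_cont p : {for t, continuous (fun s => cq s p)}.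
  by apply: differentiable_continuous; have [] := has_grad_q p t.
have cu_cont p : {for t, continuous (fun s => cu s p)}.
  by apply: differentiable_continuous; have [] := has_grad_u p t.
have cA : {for t, continuous A} := continuous_bigsum (fun p =>
  @continuous_crit_slope _ _ (fun s => cu s p) (fun s => cq s p)
    (fun s => crit_pt s j) (fun=> v0) t (cq_cont p) cv (cu_cont p)
    (@cst_continuous _ _ v0 t) (rho0 p) (rho0 p)).
(* At [s = t] the slope is [G''(v_j)], and its nonvanishing is the nondegeneracy that the division
   by [A] requires. *)
have A0 : A t = hess (cq t) (cu t) (crit_pt t) j.
  rewrite /hess mulr_sumr; apply: eq_bigr => p _.
  by have := rho0 p; rewrite /pole -/v0 => r0; field.
have nq p : \forall s \near t, v0 - cq s p != 0.
  apply: (@near_neq0 _ _ (fun s => v0 - cq s p)) (rho0 p) _.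
  by apply: differentiable_continuous;
    have [] := has_gradB (has_grad_cst v0 t) (has_grad_q p t).
have {}nq : \forall s \near t, forall p, v0 - cq s p != 0.
  exact: (@filter_forall _ _ _ _ (nbhs_filter t) nq).
eexists; apply: has_grad_div0 hD D0 cA _ _.
  by rewrite A0; apply: hess_neq0;
    [exact: (crit_pt_inj hU)|move=> i p; exact: (crit_pt_pole hU)|exact: (crit_ptP hU)].
near=> s; have Us : U s by near: s; exact: open_nbhs_nbhs (conj (chart_open hU) Ut).
have rs p : v0 - cq s p != 0 by move: p; near: s.
rewrite /D -(crit_ptP hU Us j) -sumrB mulr_sumr; apply: eq_bigr => p _.
by have r1 := rs p; have r2 := rhos s p Us; rewrite /pole -/v0; field; rewrite r1 r2.
Unshelve. all: by end_near. Qed.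

Lemma has_grad_critical_value t j : U t ->
  has_grad (fun s => critical_value a b alpha s j) t
    (fun i => dG (cq t) (cu t) (crit_pt t) (dU R i) (dQ t i) j).
Proof.
move=> Ut; have [w hw] := has_grad_crit_pt j Ut.
pose G (s : 'rV[C R]_(m + m)) : C R :=
  crit_pt s j + \sum_p cu s p * (crit_pt s j * (crit_pt s j - cq s p)^-1).
have GE s : U s -> G s = critical_value a b alpha s j.
  by move=> Us; rewrite (critical_value_crit_pt hU).
apply: (open_has_grad (chart_open hU) Ut GE).
have r0 p : crit_pt t j - cq t p != 0.
  by rewrite subr_eq0; exact: (crit_pt_pole hU Ut).
have hp p := has_gradM (has_grad_u p t)
  (has_gradM hw (has_gradV (r0 p) (has_gradB hw (has_grad_q p t)))).
apply: eq_has_grad (has_gradD hw (has_grad_sum (P := xpredT) (fun p _ => hp p))) _.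
(* Expanding the first [w i] by the critical equation makes the contribution of the moving critical
   point cancel summand by summand. *)
move=> i /=; rewrite /dG mulr_sumr -{1}[w i]mulr1 -(crit_ptP hU Ut j).
rewrite mulr_sumr -big_split.
apply: eq_bigr => p _; rewrite /pole /=; have rp := r0 p; field.
by rewrite rp.
Qed.

End CriticalPoints.

(** * Derivatives of the prepotential *)

Lemma sum_neq_swap (V : nmodType) (m : nat) (f : 'I_m -> 'I_m -> V) :
  \sum_k \sum_(s | s != k) f k s = \sum_k \sum_(s | s != k) f s k.
Proof.
rewrite (exchange_big_dep xpredT) //=; apply: eq_bigr => k _.
by apply: eq_bigl => s; rewrite eq_sym.
Qed.

Section PotentialDerivatives.
Variables (R : realType) (m : nat).
Variables (U : set 'rV[C R]_(m + m)).
Variables (L1 : 'I_m -> 'rV[C R]_(m + m) -> C R).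
Variables (L2 : 'I_m -> 'I_m -> 'rV[C R]_(m + m) -> C R).
Hypothesis oU : open U.
Hypothesis u_neq0 : forall t s, U t -> cu t s != 0.
Hypothesis q_inj : forall t, U t -> injective (cq t).
Hypothesis hL1 : forall k : 'I_m, log_branch U (L1 k) (fun t => t 0 (hi k)).
Hypothesis hL2 : forall k s : 'I_m, s != k ->
  log_branch U (L2 k s) (fun t => expC (t 0 (lo s)) - expC (t 0 (lo k))).
Implicit Types (t : 'rV[C R]_(m + m)) (k s p : 'I_m).

Let F := prepotential_phi0 L1 L2.

Definition qsub t k s : C R := (cq t k - cq t s)^-1.

(** [pot_u] and [pot_t] are closed forms of the first partials of [F]; [pot_uu], [pot_tu] and
    [pot_tt] are those of the second. [L2 k s] and [L2 s k] are logarithms of opposite numbers on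
    independent branches, so they are kept apart although their derivatives agree. *)
Definition pot_u k t : C R :=
  cq t k + cu t k * (t 0 (lo k) + L1 k t) + 2^-1 * cu t k +
  2^-1 * \sum_(s | s != k) cu t s * (L2 k s t + L2 s k t).

Definition pot_t k t : C R :=
  cu t k * cq t k + 2^-1 * cu t k ^+ 2 +
  \sum_(s | s != k) cu t k * cu t s * cq t k * qsub t k s.

Definition pot_uu k s t : C R :=
  (* The constant collects 1, from [u * log u] differentiated, and the 1/2 carried by [pot_u]. *)
  if k == s then t 0 (lo k) + L1 k t + (3 / 2)
  else 2^-1 * (L2 k s t + L2 s k t).

Definition pot_tu k s t : C R :=
  if k == s then cq t k + cu t k + \sum_(p | p != k) cu t p * cq t k * qsub t k p
  else cu t k * cq t k * qsub t k s.

Definition pot_tt k s t : C R :=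
  if k == s then cu t k * cq t k -
    \sum_(p | p != k) cu t k * cq t k * cu t p * cq t p * qsub t k p ^+ 2
  else cu t k * cq t k * cu t s * cq t s * qsub t k s ^+ 2.

Let q_sub t k s : U t -> k != s -> cq t k - cq t s != 0.
Proof. by move=> Ut ks; rewrite subr_eq0 (inj_eq (q_inj Ut)). Qed.

Let g_t k t : has_grad (fun t => t 0 (lo k)) t (fun i => dT R i k).
Proof. exact: has_grad_coord. Qed.

Let g_L1 k t : U t -> has_grad (L1 k) t (fun i => dU R i k / cu t k).
Proof. move=> Ut; exact: has_grad_log oU Ut (hL1 k) (has_grad_u k t). Qed.

Let g_L2 k s t : U t -> s != k ->
  has_grad (L2 k s) t (fun i => (dQ t i s - dQ t i k) / (cq t s - cq t k)).
Proof.
move=> Ut sk.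
exact: has_grad_log oU Ut (hL2 sk) (has_gradB (has_grad_q s t) (has_grad_q k t)).
Qed.

Let g_qsub k s t : U t -> k != s ->
  has_grad (fun t => qsub t k s) t
    (fun i => - (dQ t i k - dQ t i s) * qsub t k s ^+ 2).
Proof.
move=> Ut ks.
apply: eq_has_grad (has_gradV (q_sub Ut ks)
  (has_gradB (has_grad_q k t) (has_grad_q s t))) _.
by move=> i; rewrite /qsub exprVn.
Qed.

Lemma has_grad_potential t : U t -> has_grad F t (fun i =>
  \sum_k (dU R i k * pot_u k t + dT R i k * pot_t k t)).
Proof.
move=> Ut; apply: eq_has_grad.
  apply: has_gradD; [apply: has_gradD|].
  - apply: has_grad_sum => k _.
    exact: has_gradM (has_grad_u k t) (has_grad_q k t).
  - apply: has_gradZ; apply: has_grad_sum => k _.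
    apply: has_gradM (has_gradM (has_grad_u k t) (has_grad_u k t)) _.
    exact: has_gradD (g_t k t) (g_L1 k Ut).
  - apply: has_gradZ; apply: has_grad_sum => k _; apply: has_grad_sum => s sk.
    exact: has_gradM (has_gradM (has_grad_u k t) (has_grad_u s t)) (g_L2 Ut sk).
move=> i /=.
(* The derivative of a summand splits into the part along index [s], which is [f], and the part
   along [k], which is [g]; exchanging the indices in [f] lets both multiply [dU R i k] or
   [dT R i k]. *)
pose f k s := dU R i s * cu t k * L2 k s t +
  cu t k * cu t s * dQ t i s * (cq t s - cq t k)^-1.
pose g k s := dU R i k * cu t s * L2 k s t +
  cu t k * cu t s * dQ t i k * (cq t k - cq t s)^-1.
rewrite [X in _ + 2^-1 * X = _](_ : _ =
  \sum_k \sum_(s | s != k) f k s + \sum_k \sum_(s | s != k) g k s); last first.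
  rewrite -big_split; apply: eq_bigr => k _; rewrite -big_split.
  apply: eq_bigr => s sk; have ks : k != s by rewrite eq_sym.
  have d1 := q_sub Ut sk; have d2 := q_sub Ut ks; rewrite /f /g /cu /cq /=; field.
  by rewrite d1 d2.
rewrite sum_neq_swap -big_split !mulr_sumr -!big_split; apply: eq_bigr => k _ /=.
rewrite -big_split (eq_bigr (fun s => dU R i k * (cu t s * (L2 k s t + L2 s k t)) +
    dT R i k * 2 * (cu t k * cu t s * cq t k * qsub t k s))) => [|s sk]; last first.
  by rewrite /f /g /qsub /dQ /=; ring.
rewrite big_split -!mulr_sumr /= /pot_u /pot_t /dQ.
have u0 := u_neq0 k Ut; move: u0; rewrite /cu /cq => u0; field.
by rewrite u0.
Qed.

Lemma has_grad_pot_u k t : U t -> has_grad (pot_u k) t (fun i =>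
  \sum_s (dU R i s * pot_uu k s t + dT R i s * pot_tu s k t)).
Proof.
move=> Ut; apply: eq_has_grad.
  apply: has_gradD; [apply: has_gradD; [apply: has_gradD|]|].
  - exact: has_grad_q.
  - exact: has_gradM (has_grad_u k t) (has_gradD (g_t k t) (g_L1 k Ut)).
  - exact: has_gradZ (has_grad_u k t).
  - apply: has_gradZ; apply: has_grad_sum => s sk.
    have ks : k != s by rewrite eq_sym.
    exact: has_gradM (has_grad_u s t) (has_gradD (g_L2 Ut sk) (g_L2 Ut ks)).
move=> i /=; rewrite [RHS](bigD1 k) //= {1}/pot_uu {1}/pot_tu !eqxx.
rewrite mulr_sumr (eq_bigr (fun s => dT R i k * (cu t s * cq t k * qsub t k s) +
  (dU R i s * pot_uu k s t + dT R i s * pot_tu s k t))) => [|s sk]; last first.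
  have ks : k != s by rewrite eq_sym.
  rewrite /pot_uu /pot_tu (negPf sk) (negPf ks) /dQ /qsub.
  have d1 := q_sub Ut sk; have d2 := q_sub Ut ks; field.
  by rewrite d1 d2.
rewrite big_split -mulr_sumr /= /dQ.
by have u0 := u_neq0 k Ut; field; rewrite u0.
Qed.

Lemma has_grad_pot_t k t : U t -> has_grad (pot_t k) t (fun i =>
  \sum_s (dU R i s * pot_tu k s t + dT R i s * pot_tt k s t)).
Proof.
move=> Ut; apply: eq_has_grad.
  apply: has_gradD; [apply: has_gradD|].
  - exact: has_gradM (has_grad_u k t) (has_grad_q k t).
  - apply: has_gradZ; exact: has_gradM (has_grad_u k t) (has_grad_u k t).
  - apply: has_grad_sum => s sk; have ks : k != s by rewrite eq_sym.
    apply: has_gradM _ (g_qsub Ut ks).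
    exact: has_gradM (has_gradM (has_grad_u k t) (has_grad_u s t)) (has_grad_q k t).
move=> i /=; rewrite [RHS](bigD1 k) //= {1}/pot_tu {1}/pot_tt !eqxx.
rewrite (eq_bigr (fun s => dU R i k * (cu t s * cq t k * qsub t k s) +
  - dT R i k * (cu t k * cq t k * cu t s * cq t s * qsub t k s ^+ 2) +
  (dU R i s * pot_tu k s t + dT R i s * pot_tt k s t))) => [|s sk]; last first.
  have ks : k != s by rewrite eq_sym.
  rewrite /pot_tt /pot_tu (negPf ks) /dQ /qsub.
  have d2 := q_sub Ut ks; field.
  by rewrite d2.
rewrite !big_split -!mulr_sumr /= /dQ.
by field.
Qed.

Lemma has_grad_pot_uu_eq k t : U t -> has_grad (pot_uu k k) t (fun i =>
  dU R i k / cu t k + dQ t i k / cq t k).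
Proof.
move=> Ut; rewrite /pot_uu eqxx.
apply: eq_has_grad (has_gradD (has_gradD (g_t k t) (g_L1 k Ut)) (has_grad_cst _ t)) _.
move=> i; have u0 := u_neq0 k Ut; have q0 := cq_neq0 t k; rewrite /dQ; field.
by rewrite u0 q0.
Qed.

Lemma has_grad_pot_uu_neq k s t : U t -> k != s -> has_grad (pot_uu k s) t (fun i =>
  (dQ t i k - dQ t i s) / (cq t k - cq t s)).
Proof.
move=> Ut ks; have sk : s != k by rewrite eq_sym.
rewrite /pot_uu (negPf ks).
apply: eq_has_grad (has_gradZ _ (has_gradD (g_L2 Ut sk) (g_L2 Ut ks))) _ => i.
have d1 := q_sub Ut sk; have d2 := q_sub Ut ks; field.
by rewrite d1 d2.
Qed.

Lemma has_grad_pot_tu_neq k s t : U t -> k != s -> has_grad (pot_tu k s) t (fun i =>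
  (dU R i k * cq t k + cu t k * dQ t i k) / (cq t k - cq t s)
  - cu t k * cq t k * (dQ t i k - dQ t i s) / (cq t k - cq t s) ^+ 2).
Proof.
move=> Ut ks; rewrite /pot_tu (negPf ks).
apply: eq_has_grad (has_gradM (has_gradM (has_grad_u k t) (has_grad_q k t))
  (g_qsub Ut ks)) _ => i.
by have d2 := q_sub Ut ks; rewrite /qsub; field; rewrite d2.
Qed.

Lemma has_grad_pot_tu_eq k t : U t -> has_grad (pot_tu k k) t (fun i =>
  dQ t i k + dU R i k + \sum_(s | s != k)
    ((dU R i s * cq t k + cu t s * dQ t i k) / (cq t k - cq t s)
    - cu t s * cq t k * (dQ t i k - dQ t i s) / (cq t k - cq t s) ^+ 2)).
Proof.
move=> Ut; rewrite /pot_tu eqxx.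
apply: has_gradD; first exact: has_gradD (has_grad_q k t) (has_grad_u k t).
apply: has_grad_sum => s sk; have ks : k != s by rewrite eq_sym.
apply: eq_has_grad (has_gradM (has_gradM (has_grad_u s t) (has_grad_q k t))
  (g_qsub Ut ks)) _ => i.
by have d2 := q_sub Ut ks; rewrite /qsub; field; rewrite d2.
Qed.

Let g_tt k s t : U t -> k != s ->
  has_grad (fun t => cu t k * cq t k * cu t s * cq t s * qsub t k s ^+ 2) t (fun i =>
  (cu t s * cq t s * (dU R i k * cq t k + cu t k * dQ t i k) +
   cu t k * cq t k * (dU R i s * cq t s + cu t s * dQ t i s))
    / (cq t k - cq t s) ^+ 2
  - 2 * cu t k * cq t k * cu t s * cq t s * (dQ t i k - dQ t i s)
    / (cq t k - cq t s) ^+ 3).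
Proof.
move=> Ut ks.
apply: eq_has_grad (has_gradM (has_gradM (has_gradM (has_gradM (has_grad_u k t)
  (has_grad_q k t)) (has_grad_u s t)) (has_grad_q s t))
  (has_gradM (g_qsub Ut ks) (g_qsub Ut ks))) _ => i.
by have d2 := q_sub Ut ks; rewrite /qsub; field; rewrite d2.
Qed.

Lemma has_grad_pot_tt_neq k s t : U t -> k != s -> has_grad (pot_tt k s) t (fun i =>
  (cu t s * cq t s * (dU R i k * cq t k + cu t k * dQ t i k) +
   cu t k * cq t k * (dU R i s * cq t s + cu t s * dQ t i s))
    / (cq t k - cq t s) ^+ 2
  - 2 * cu t k * cq t k * cu t s * cq t s * (dQ t i k - dQ t i s)
    / (cq t k - cq t s) ^+ 3).
Proof. by move=> Ut ks; rewrite /pot_tt (negPf ks); exact: g_tt. Qed.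

Lemma has_grad_pot_tt_eq k t : U t -> has_grad (pot_tt k k) t (fun i =>
  dU R i k * cq t k + cu t k * dQ t i k - \sum_(s | s != k) (
  (cu t s * cq t s * (dU R i k * cq t k + cu t k * dQ t i k) +
   cu t k * cq t k * (dU R i s * cq t s + cu t s * dQ t i s))
    / (cq t k - cq t s) ^+ 2
  - 2 * cu t k * cq t k * cu t s * cq t s * (dQ t i k - dQ t i s)
    / (cq t k - cq t s) ^+ 3)).
Proof.
move=> Ut; rewrite /pot_tt eqxx.
apply: has_gradB; first exact: has_gradM (has_grad_u k t) (has_grad_q k t).
by apply: has_grad_sum => s sk; apply: g_tt => //; rewrite eq_sym.
Qed.

Let sum_hi (f g : 'I_m -> C R) k :
  \sum_s (dU R (hi k) s * f s + dT R (hi k) s * g s) = f k.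
Proof.
rewrite (bigD1 k) //= /dU /dT eqxx eq_sym lo_neq_hi mul1r mul0r addr0.
rewrite big1 ?addr0 // => s sk.
by rewrite (inj_eq (@hi_inj m)) [k == s]eq_sym (negPf sk) eq_sym lo_neq_hi !mul0r addr0.
Qed.

Let sum_lo (f g : 'I_m -> C R) k :
  \sum_s (dU R (lo k) s * f s + dT R (lo k) s * g s) = g k.
Proof.
rewrite (bigD1 k) //= /dU /dT eqxx lo_neq_hi mul1r mul0r add0r.
rewrite big1 ?addr0 // => s sk.
by rewrite (inj_eq (@lo_inj m)) [k == s]eq_sym (negPf sk) lo_neq_hi !mul0r addr0.
Qed.

Lemma pd_hi_potential k t : U t -> pd (hi k) F t = pot_u k t.
Proof. by move=> Ut; rewrite (has_grad_pd _ (has_grad_potential Ut)) sum_hi. Qed.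

Lemma pd_lo_potential k t : U t -> pd (lo k) F t = pot_t k t.
Proof. by move=> Ut; rewrite (has_grad_pd _ (has_grad_potential Ut)) sum_lo. Qed.

Lemma has_grad_pd_hi k t : U t -> has_grad (pd (hi k) F) t (fun i =>
  \sum_s (dU R i s * pot_uu k s t + dT R i s * pot_tu s k t)).
Proof.
move=> Ut; apply: (open_has_grad oU Ut _ (has_grad_pot_u k Ut)) => s Us.
by rewrite pd_hi_potential.
Qed.

Lemma has_grad_pd_lo k t : U t -> has_grad (pd (lo k) F) t (fun i =>
  \sum_s (dU R i s * pot_tu k s t + dT R i s * pot_tt k s t)).
Proof.
move=> Ut; apply: (open_has_grad oU Ut _ (has_grad_pot_t k Ut)) => s Us.
by rewrite pd_lo_potential.
Qed.

Lemma pd_hi_hi k s t : U t -> pd (hi s) (pd (hi k) F) t = pot_uu k s t.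
Proof. by move=> Ut; rewrite (has_grad_pd _ (has_grad_pd_hi k Ut)) sum_hi. Qed.

Lemma pd_lo_hi k s t : U t -> pd (lo s) (pd (hi k) F) t = pot_tu s k t.
Proof. by move=> Ut; rewrite (has_grad_pd _ (has_grad_pd_hi k Ut)) sum_lo. Qed.

Lemma pd_hi_lo k s t : U t -> pd (hi s) (pd (lo k) F) t = pot_tu k s t.
Proof. by move=> Ut; rewrite (has_grad_pd _ (has_grad_pd_lo k Ut)) sum_hi. Qed.

Lemma pd_lo_lo k s t : U t -> pd (lo s) (pd (lo k) F) t = pot_tt k s t.
Proof. by move=> Ut; rewrite (has_grad_pd _ (has_grad_pd_lo k Ut)) sum_lo. Qed.

Lemma euler_potential t : U t ->
  euler F t = 2 * F t + \sum_(k < m) t 0 (hi k) ^+ 2 +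
    2^-1 * \sum_(k < m) \sum_(s < m | s != k) t 0 (hi k) * t 0 (hi s).
Proof.
move=> Ut; rewrite /euler.
rewrite (eq_bigr (fun k => pot_t k t + cu t k * pot_u k t)) => [|k _]; last first.
  by rewrite pd_lo_potential // pd_hi_potential.
(* Exchanging [k] and [s] and adding gives [q k / (q k - q s) + q s / (q s - q k) = 1]; this is the
   source of the double sum in the quasi-homogeneity defect. *)
have sym1 : \sum_k \sum_(s | s != k) cu t k * cu t s * cq t k * qsub t k s =
    2^-1 * \sum_k \sum_(s | s != k) cu t k * cu t s.
  apply: (@mulfI _ 2) => //; rewrite mulrA divff // mul1r mulrDl mul1r.
  rewrite {2}sum_neq_swap -big_split; apply: eq_bigr => k _; rewrite -big_split.
  apply: eq_bigr => s sk; have ks : k != s by rewrite eq_sym.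
  have d1 := q_sub Ut sk; have d2 := q_sub Ut ks; rewrite /qsub /=; field.
  by rewrite d1 d2.
have sym2 : \sum_k \sum_(s | s != k) cu t k * cu t s * L2 s k t =
    \sum_k \sum_(s | s != k) cu t k * cu t s * L2 k s t.
  by rewrite sum_neq_swap; apply: eq_bigr => k _; apply: eq_bigr => s _; ring.
have e1 : \sum_k cu t k * \sum_(s | s != k) cu t s * (L2 k s t + L2 s k t) =
    2 * \sum_k \sum_(s | s != k) cu t k * cu t s * L2 k s t.
  rewrite mulrDl mul1r -{2}sym2 -big_split; apply: eq_bigr => k _.
  by rewrite mulr_sumr -big_split; apply: eq_bigr => s _ /=; ring.
(* The lone square [cu t k ^+ 2] is one half from [pot_t] and one half from [cu t k * pot_u k t]. *)
rewrite (eq_bigr (fun k => 2 * (cu t k * cq t k) +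
   (cu t k ^+ 2 * (t 0 (lo k) + L1 k t)) + cu t k ^+ 2 +
   \sum_(s | s != k) cu t k * cu t s * cq t k * qsub t k s +
   2^-1 * (cu t k * \sum_(s | s != k) cu t s * (L2 k s t + L2 s k t))))
  => [|k _]; last first.
  by rewrite /pot_u /pot_t; field.
rewrite !big_split -!mulr_sumr /= sym1 e1 /F /prepotential_phi0 /cu /cq; by field.
Qed.

End PotentialDerivatives.

(** * Third derivatives and the WDVV equations *)

(* [M] holds the components of the flat frame in the frame of idempotents, where
   the metric and all the multiplications are diagonal. *)
Lemma diagonalizable_wdvv (K : fieldType) (n : nat) (M : 'M[K]_n) (w : 'rV[K]_n)
    (eta : 'M[K]_n) (F : 'I_n -> 'M[K]_n) :
  eta \in unitmx -> eta = M *m diag_mx w *m M^T ->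
  (forall i, F i = M *m diag_mx (row i M) *m diag_mx w *m M^T) ->
  (forall i j, F i *m invmx eta *m F j = F j *m invmx eta *m F i) /\
  eta = \sum_i (const_mx 1 *m invmx M : 'rV[K]_n) 0 i *: F i.
Proof.
move=> eta_unit etaE FE.
have /andP[/andP[uM uW] uMT] :
    (M \in unitmx) && (diag_mx w \in unitmx) && (M^T \in unitmx).
  by rewrite -!unitmx_mul -etaE.
have FF i j : F i *m invmx eta *m F j =
    M *m (diag_mx (row i M) *m diag_mx (row j M)) *m diag_mx w *m M^T.
  have -> : F i = M *m diag_mx (row i M) *m invmx M *m eta.
    by rewrite FE etaE !mulmxA mulmxKV.
  by rewrite mulmxK // FE !mulmxA mulmxKV.
split=> [i j|]; first by rewrite !FF [X in M *m X]diag_mxC.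
(* The coefficients [1 M^-1] are the components of the unit field in the flat frame: they combine
   the rows of [M] into the all-ones row, and multiplication by the unit is the identity. *)
have -> : \sum_i (const_mx 1 *m invmx M : 'rV[K]_n) 0 i *: F i =
    M *m diag_mx (\sum_i (const_mx 1 *m invmx M : 'rV[K]_n) 0 i *: row i M)
      *m diag_mx w *m M^T.
  rewrite raddf_sum /= mulmx_sumr !mulmx_suml; apply: eq_bigr => i _.
  by rewrite FE linearZ /= -scalemxAr -!scalemxAl.
by rewrite -mulmx_sum_row mulmxKV // diag_const_mx mulmx1.
Qed.

Lemma eta_mx_unit (R : realType) (m : nat) : eta_mx R m \in unitmx.
Proof.
suff e : eta_mx R m *m eta_mx R m = 1%:M by have [] := mulmx1_unit e.
apply/matrixP => i j; rewrite !mxE (bigD1 (rev_ord i)) //= big1 => [|k ki]; last first.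
  rewrite !mxE; case: eqP => [e|_]; last by rewrite mul0r.
  by case/eqP: ki; apply: val_inj => /=; have := ltn_ord i; lia.
rewrite !mxE addr0 /= -(inj_eq val_inj) /=.
have := ltn_ord i; have := ltn_ord j => jm im.
have -> : (i.+1 + (m + m - i.+1).+1 == (m + m).+1)%N by lia.
by rewrite mul1r; congr (_%:R); apply/eqP/eqP; lia.
Qed.

Section StructureTensor.
Variables (R : realType) (m : nat) (U : set 'rV[C R]_(m + m)).
Variables (a b : 'rV[C R]_(m + m) -> 'I_m.+1 -> C R).
Variables (alpha : 'rV[C R]_(m + m) -> 'I_(m + m) -> C R).
Variables (x : 'rV[C R]_(m + m) -> 'I_(m + m) -> C R -> C R).
Hypothesis hU : flat_chart U a b alpha x.
Variables (L1 : 'I_m -> 'rV[C R]_(m + m) -> C R).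
Variables (L2 : 'I_m -> 'I_m -> 'rV[C R]_(m + m) -> C R).
Hypothesis hL1 : forall k : 'I_m, log_branch U (L1 k) (fun t => t 0 (hi k)).
Hypothesis hL2 : forall k s : 'I_m, s != k ->
  log_branch U (L2 k s) (fun t => expC (t 0 (lo s)) - expC (t 0 (lo k))).
Implicit Types (t : 'rV[C R]_(m + m)).
Let F := prepotential_phi0 L1 L2.
Let oU := chart_open hU.

(** The factor [v] of [d_i G] is left out because the metric weight [1 / (v^2 G'')] cancels two such
    factors. *)
Definition frame t (i j : 'I_(m + m)) : C R :=
  \sum_p (dU R i p * pole (cq t) (crit_pt alpha t) p j +
    cu t p * dQ t i p * pole (cq t) (crit_pt alpha t) p j ^+ 2).

Lemma frame_hi t k j : frame t (hi k) j = pole (cq t) (crit_pt alpha t) k j.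
Proof.
rewrite /frame (bigD1 k) //= /dQ /dU /dT eqxx eq_sym lo_neq_hi mul1r !mulr0 mul0r addr0.
rewrite big1 ?addr0 // => s sk.
rewrite (inj_eq (@hi_inj m)) [k == s]eq_sym (negPf sk) [hi k == _]eq_sym lo_neq_hi.
by rewrite !mul0r !mulr0 mul0r addr0.
Qed.

Lemma frame_lo t k j : frame t (lo k) j =
  cu t k * cq t k * pole (cq t) (crit_pt alpha t) k j ^+ 2.
Proof.
rewrite /frame (bigD1 k) //= /dQ /dU /dT eqxx lo_neq_hi mul0r mulr1 add0r.
rewrite big1 ?addr0 // => s sk.
rewrite (inj_eq (@lo_inj m)) [k == s]eq_sym (negPf sk) lo_neq_hi.
by rewrite mul0r !mulr0 mul0r addr0.
Qed.

Section Point.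
Variable t : 'rV[C R]_(m + m).
Hypothesis Ut : U t.
Let q := cq t.
Let u := cu t.
Let v := crit_pt alpha t.
Let q_inj : injective q := cq_inj hU Ut.
Let v_inj : injective v := crit_pt_inj hU Ut.
Let v_pole j p : v j != q p := crit_pt_pole hU Ut j p.
Let v_crit j := crit_ptP hU Ut j.
Let u_neq0 s : u s != 0 := cu_neq0 hU Ut s.
Let q_neq0 s : q s != 0 := cq_neq0 t s.

Lemma coord_fieldE i j : coord_field a b alpha i t j = v j * frame t i j.
Proof. by rewrite /coord_field (has_grad_pd _ (has_grad_critical_value hU j Ut)). Qed.

Lemma metric_frame i j k :
  metric (phi0_at alpha x t)
    (circ (coord_field a b alpha i t) (coord_field a b alpha j t))
    (coord_field a b alpha k t) =
  dG_sum q u v (dU R i) (dQ t i) (fun l => frame t j l * frame t k l).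
Proof.
rewrite /metric mulr_sumr; apply: eq_bigr => l _.
rewrite /circ -!(mulrA (phi0_at _ _ _ _ ^+ 2)) [LHS]mulrA (phi0_at_sqr hU Ut).
rewrite !coord_fieldE.
have v0 := crit_pt_neq0 hU Ut l.
have h0 := hess_neq0 v_inj v_pole v_crit l.
rewrite /dG -/(frame t i l) -/v; field.
by rewrite h0 v0.
Qed.

(** The comparison of the two sides: in each case, by type of the indices and by their equality, the
    gradient of the Hessian entry is the matching [dG_sum] formula. Both orders of a mixed partial
    reduce to [pot_tu]. *)
Lemma has_grad_pd_pd j k : has_grad (pd j (pd k F)) t (fun i =>
  dG_sum q u v (dU R i) (dQ t i) (fun l => frame t j l * frame t k l)).
Proof.
have u0 : forall t s, U t -> cu t s != 0 by move=> s p Us; exact: (cu_neq0 hU Us).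
have qi : forall t, U t -> injective (cq t) by move=> s Us; exact: (cq_inj hU Us).
have sumE f g x0 y0 : f =1 g -> dG_sum q u v x0 y0 f = dG_sum q u v x0 y0 g.
  by move=> /funext ->.
have comm : forall j k i,
    dG_sum q u v (dU R i) (dQ t i) (fun l => frame t j l * frame t k l) =
    dG_sum q u v (dU R i) (dQ t i) (fun l => frame t k l * frame t j l).
  by move=> j0 k0 i; apply: sumE => l; rewrite mulrC.
have tu j0 k0 : has_grad (pot_tu j0 k0) t (fun i =>
  dG_sum q u v (dU R i) (dQ t i) (fun l => frame t (lo j0) l * frame t (hi k0) l)).
  have [<-|jk] := eqVneq j0 k0.
    apply: eq_has_grad (has_grad_pot_tu_eq qi j0 Ut) _ => i.
    rewrite -(dG_sum_pole3 q_inj v_inj v_pole v_crit).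
    by apply: sumE => l; rewrite frame_lo frame_hi.
  apply: eq_has_grad (has_grad_pot_tu_neq qi Ut jk) _ => i.
  rewrite -(dG_sum_pole21 q_inj v_inj v_pole v_crit) //.
  by apply: sumE => l; rewrite frame_lo frame_hi.
case: (lo_hiP j) => j0; case: (lo_hiP k) => k0.
- apply: (open_has_grad (F := pot_tt k0 j0) oU Ut).
    by move=> s Us; rewrite (pd_lo_lo oU u0 qi hL1 hL2).
  have [<-|kj] := eqVneq k0 j0.
    apply: eq_has_grad (has_grad_pot_tt_eq qi k0 Ut) _ => i.
    rewrite -(dG_sum_pole4 q_inj v_inj v_pole v_crit).
    by apply: sumE => l; rewrite !frame_lo.
  apply: eq_has_grad (has_grad_pot_tt_neq qi Ut kj) _ => i.
  rewrite -(dG_sum_pole22 q_inj v_inj v_pole v_crit) //.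
  by apply: sumE => l; rewrite !frame_lo mulrC.
- apply: (open_has_grad (F := pot_tu j0 k0) oU Ut) (tu _ _).
  by move=> s Us; rewrite (pd_lo_hi oU u0 qi hL1 hL2).
- apply: (open_has_grad (F := pot_tu k0 j0) oU Ut).
    by move=> s Us; rewrite (pd_hi_lo oU u0 qi hL1 hL2).
  by apply: eq_has_grad (tu k0 j0) _ => i; rewrite comm.
- apply: (open_has_grad (F := pot_uu L1 L2 k0 j0) oU Ut).
    by move=> s Us; rewrite (pd_hi_hi oU u0 qi hL1 hL2).
  have [<-|kj] := eqVneq k0 j0.
    apply: eq_has_grad (has_grad_pot_uu_eq L2 oU u0 hL1 k0 Ut) _ => i.
    rewrite -(dG_sum_pole2 q_inj v_inj v_pole v_crit) //.
    by apply: sumE => l; rewrite !frame_hi.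
  apply: eq_has_grad (has_grad_pot_uu_neq L1 oU qi hL2 Ut kj) _ => i.
  rewrite -(dG_sum_pole11 q_inj v_inj v_pole v_crit (dU R i)) //.
  by apply: sumE => l; rewrite !frame_hi mulrC.
Qed.

Let M : 'M[C R]_(m + m) := \matrix_(i, j) coord_field a b alpha i t j.
Let w : 'rV[C R]_(m + m) := \row_j (v j ^+ 2 * hess q u v j)^-1.

(** Flatness of the coordinates: the Gram matrix of the metric is constant. Two [hi] directions pair
    to 0 by [crit_sum_pole11], two [lo] directions by [crit_sum_pole22], and [lo] with [hi] gives
    the Kronecker delta by [crit_sum_pole12]. *)
Lemma eta_frame : eta_mx R m = M *m diag_mx w *m M^T.
Proof.
have sumE i j : (M *m diag_mx w *m M^T) i j =
    crit_sum q u v (fun l => frame t i l * frame t j l).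
  rewrite mul_mx_diag mxE; apply: eq_bigr => l _; rewrite !mxE !coord_fieldE.
  have v0 := crit_pt_neq0 hU Ut l.
  have h0 := hess_neq0 v_inj v_pole v_crit l.
  by rewrite -/v; field; rewrite h0 v0.
have ext f g : f =1 g -> crit_sum q u v f = crit_sum q u v g by move=> /funext ->.
have Z c f : crit_sum q u v (fun l => c * f l) = c * crit_sum q u v f.
  by rewrite mulr_sumr; apply: eq_bigr => l _; rewrite mulrA.
have p12 := crit_sum_pole12 q_inj v_inj v_pole v_crit.
have p22 := crit_sum_pole22 q_inj v_inj v_pole v_crit.
have p11 := crit_sum_pole11 q_inj v_inj v_pole v_crit.
apply/matrixP => i j; rewrite sumE mxE.
case: (lo_hiP i) => i0; case: (lo_hiP j) => j0.
- rewrite (ext _ (fun l => u i0 * q i0 * (u j0 * q j0 *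
    (pole q v i0 l ^+ 2 * pole q v j0 l ^+ 2)))) => [|l]; last first.
    by rewrite !frame_lo -/u -/q -/v; ring.
  rewrite !Z p22 mulr0 (_ : (_ == _) = false) //.
  by apply/negbTE; rewrite /=; have := ltn_ord i0; have := ltn_ord j0; lia.
- rewrite (ext _ (fun l => u i0 * q i0 * (pole q v j0 l * pole q v i0 l ^+ 2)))
    => [|l]; last first.
    by rewrite frame_lo frame_hi -/u -/q -/v; ring.
  rewrite Z p12; congr (_%:R); rewrite -(inj_eq val_inj) /=.
  by have := ltn_ord i0; have := ltn_ord j0; lia.
- rewrite (ext _ (fun l => u j0 * q j0 * (pole q v i0 l * pole q v j0 l ^+ 2)))
    => [|l]; last first.
    by rewrite frame_lo frame_hi -/u -/q -/v; ring.
  rewrite Z p12; congr (_%:R); rewrite -(inj_eq val_inj) /=.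
  by have := ltn_ord i0; have := ltn_ord j0; lia.
- rewrite (ext _ (fun l => pole q v i0 l * pole q v j0 l)) => [|l].
    rewrite p11 (_ : (_ == _) = false) //.
    by apply/negbTE; rewrite /=; have := ltn_ord i0; have := ltn_ord j0; lia.
  by rewrite !frame_hi.
Qed.

Lemma pd_hessian_frame i : pd_hessian F i t = M *m diag_mx (row i M) *m diag_mx w *m M^T.
Proof.
apply/matrixP => k l; rewrite !mxE.
have -> : (fun s => hessian F s k l) = pd k (pd l F) by apply/funext => s; rewrite mxE.
rewrite (has_grad_pd _ (has_grad_pd_pd k l)) -metric_frame /metric mulr_sumr.
rewrite !mul_mx_diag; apply: eq_bigr => p _; rewrite !mxE /circ.
rewrite -!(mulrA (phi0_at _ _ _ _ ^+ 2)) [LHS]mulrA (phi0_at_sqr hU Ut) -/q -/u -/v.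
move: (coord_field _ _ _ i t p) (coord_field _ _ _ k t p) (coord_field _ _ _ l t p).
by move=> ci ck cl; ring.
Qed.

Lemma wdvv_point :
  (forall i j, pd_hessian F i t *m invmx (eta_mx R m) *m pd_hessian F j t =
     pd_hessian F j t *m invmx (eta_mx R m) *m pd_hessian F i t) /\
  eta_mx R m = \sum_i (const_mx 1 *m invmx M : 'rV_(m + m)) 0 i *: pd_hessian F i t.
Proof.
exact: diagonalizable_wdvv (eta_mx_unit R m) eta_frame pd_hessian_frame.
Qed.

(** [G] is homogeneous of degree 1 when [v], all [q_s] and all [u_s] are scaled together, and the
    Euler field scales the [q_s] and [u_s]. Euler's relation gives the claim, the term in [v]
    vanishing at a critical point. *)
Lemma euler_critical_value j :
  euler (fun u => critical_value a b alpha u j) t = critical_value a b alpha t j.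
Proof.
rewrite (critical_value_crit_pt hU Ut) /euler.
rewrite -[X in X + _]mulr1 -(v_crit j) mulr_sumr -big_split; apply: eq_bigr => s _ /=.
rewrite -/(coord_field a b alpha (lo s) t j) -/(coord_field a b alpha (hi s) t j).
rewrite !coord_fieldE frame_lo frame_hi -/(cu t s) /pole -/u -/q -/v.
move: (u s) (q s) (v j) => us qs vj.
by ring.
Qed.

End Point.
End StructureTensor.

Theorem theorem6p1 (R : realType) (m : nat) (hm : (2 <= m)%N)
  (U : set 'rV[C R]_(m + m))
  (a b : 'rV[C R]_(m + m) -> 'I_m.+1 -> C R)
  (alpha : 'rV[C R]_(m + m) -> 'I_(m + m) -> C R)
  (x : 'rV[C R]_(m + m) -> 'I_(m + m) -> C R -> C R)
  (hU : flat_chart U a b alpha x)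
  (L1 : 'I_m -> 'rV[C R]_(m + m) -> C R)
  (hL1 : forall k : 'I_m, log_branch U (L1 k) (fun t => t 0 (hi k)))
  (L2 : 'I_m -> 'I_m -> 'rV[C R]_(m + m) -> C R)
  (hL2 : forall k s : 'I_m, s != k ->
     log_branch U (L2 k s) (fun t => expC (t 0 (lo s)) - expC (t 0 (lo k)))) :
  let F := prepotential_phi0 L1 L2 in
  let Fm := fun (i : 'I_(m + m)) t => pd_hessian F i t in
  [/\ is_prepotential a b alpha x U F,
      forall t (j : 'I_(m + m)), U t ->
        euler (fun u => critical_value a b alpha u j) t =
        critical_value a b alpha t j,
      forall t, U t ->
        euler F t = 2 * F t + \sum_(k < m) t 0 (hi k) ^+ 2
          + 2^-1 * \sum_(k < m) \sum_(s < m | s != k) t 0 (hi k) * t 0 (hi s),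
      forall t (i j : 'I_(m + m)), U t ->
        Fm i t *m invmx (eta_mx R m) *m Fm j t =
        Fm j t *m invmx (eta_mx R m) *m Fm i t
    & exists f : 'I_(m + m) -> 'rV[C R]_(m + m) -> C R,
        forall t, U t -> eta_mx R m = \sum_(i < m + m) f i t *: Fm i t].
Proof.
have u0 : forall t s, U t -> cu t s != 0 by move=> s p Us; exact: (cu_neq0 hU Us).
have qi : forall t, U t -> injective (cq t) by move=> s Us; exact: (cq_inj hU Us).
move=> F Fm; split.
- split=> [t Ut|i t Ut|i j t Ut|t i j k Ut].
  + by have [] := has_grad_potential (chart_open hU) u0 qi hL1 hL2 Ut.
  + case: (lo_hiP i) => s.
      by have [] := has_grad_pd_lo (chart_open hU) u0 qi hL1 hL2 s Ut.
    by have [] := has_grad_pd_hi (chart_open hU) u0 qi hL1 hL2 s Ut.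
  + by have [] := has_grad_pd_pd hU hL1 hL2 Ut i j.
  + by rewrite (has_grad_pd _ (has_grad_pd_pd hU hL1 hL2 Ut j k)) (metric_frame hU Ut).
- by move=> t j Ut; exact: (euler_critical_value hU Ut).
- by move=> t Ut; exact: (euler_potential (chart_open hU) u0 qi hL1 hL2 Ut).
- by move=> t i j Ut; have [] := wdvv_point hU hL1 hL2 Ut.
(* The witness, found by unification, consists of the flat components of the unit field at [t]. *)
- eexists => t Ut; have [_] := wdvv_point hU hL1 hL2 Ut; apply.
Qed.
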